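(* Let $J$ be a real analytic almost complex structure in a neighborhood of the origin of $\mathbb{R}^{2n}$. There is $r>0$ (sufficiently small) such that for every sequence $(x_k)_{k\in\mathbb{N}}$ of vectors of $\mathbb{R}^{2n}$ with $\sum_{k=0}^\infty\frac{k+1}{k!}|x_k|\le r$, there exists a $J$-holomorphic disc $\gamma:\mathbb{D}\to\mathbb{R}^{2n}$ such that $\frac{\partial^k\gamma}{\partial x^k}(0)=x_k$ for all $k\in\mathbb{N}$ (with $\gamma(0)=x_0$ for $k=0$).
   Context: An almost complex structure is a field $J$ of endomorphisms of the tangent spaces with $J^2=-\mathrm{Id}$; as a normalization, $J(0)=J_0$, the standard complex structure of $\mathbb{R}^{2n}=\mathbb{C}^n$ (and, without restriction, $J$ is as close to $J_0$ as needed). $\mathbb{D}\subset\mathbb{C}$ is the unit disc with its standard structure $J_0$ and coordinate $\zeta=x+iy$. A $J$-holomorphic disc is a $C^1$ map $\gamma:\mathbb{D}\to\mathbb{R}^{2n}$ (with values where $J$ is defined) such that $d\gamma(\zeta)\circ J_0=J(\gamma(\zeta))\circ d\gamma(\zeta)$ for all $\zeta\in\mathbb{D}$. $\mathbb{N}$ contains $0$. *)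

(* Defs.v *)
From HB Require Import structures.
From mathcomp Require Import all_boot all_order all_algebra.
From mathcomp Require Import all_classical all_reals all_analysis.

Set Implicit Arguments.
Unset Strict Implicit.
Unset Printing Implicit Defensive.

Import Order.TTheory GRing.Theory Num.Theory.
Import numFieldNormedType.Exports.

Local Open Scope classical_set_scope.
Local Open Scope ring_scope.

(* The library norm on ['cV[R]_m] is the sup norm; [enorm] is the Euclidean
   norm. *)
Definition enorm {R : realType} {m : nat} (v : 'cV[R]_m) : R :=
  Num.sqrt (\sum_i v i 0 ^+ 2).

(* C^n is identified with R^(n + n) by z |-> (Re z, Im z), so that
   multiplication by i sends the column (x, y) to (- y, x). The case n = 1
   is the standard structure of C, with zeta = x + i y the column (x, y). *)
Definition Jstd {R : realType} (n : nat) : 'M[R]_(n + n) :=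
  block_mx 0 (- 1%:M) 1%:M 0.

Definition unit_disc {R : realType} : set 'cV[R]_(1 + 1) :=
  [set z | enorm z < 1].

Definition monomial {R : realType} {m : nat} (alpha : {ffun 'I_m -> nat})
    (h : 'cV[R]_m) : R :=
  \prod_i h i 0 ^+ alpha i.

Definition box_index {m N : nat} (beta : {ffun 'I_m -> 'I_N}) :
    {ffun 'I_m -> nat} :=
  [ffun i => nat_of_ord (beta i)].

(* Near a, f is the sum of an absolutely convergent power series in m
   variables. As the convergence is absolute, the value of the sum may be
   computed along the boxes [0, N)^m of multi-indices. *)
Definition real_analytic_at {R : realType} {m : nat} (f : 'cV[R]_m -> R)
    (a : 'cV[R]_m) : Prop :=
  exists c : {ffun 'I_m -> nat} -> R,
    \forall h \near (0 : 'cV[R]_m),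
      summable [set: {ffun 'I_m -> nat}]
        (fun alpha => (c alpha * monomial alpha h)%:E) /\
      (fun N : nat => \sum_(beta : {ffun 'I_m -> 'I_N})
          c (box_index beta) * monomial (box_index beta) h) @ \oo
        --> f (a + h).

(* The endomorphism of the tangent space at p is v |-> J p *m v. *)
Definition almost_complex_on {R : realType} {n : nat}
    (U : set 'cV[R]_(n + n)) (J : 'cV[R]_(n + n) -> 'M[R]_(n + n)) : Prop :=
  forall p, U p -> J p *m J p = - 1%:M.

Definition real_analytic_on {R : realType} {m k l : nat}
    (U : set 'cV[R]_m) (F : 'cV[R]_m -> 'M[R]_(k, l)) : Prop :=
  forall p, U p -> forall i j, real_analytic_at (fun q => F q i j) p.

(* gamma is a total function; only its values on the (open) unit disc
   matter. *)
Definition J_holomorphic_disc {R : realType} {n : nat}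
    (U : set 'cV[R]_(n + n)) (J : 'cV[R]_(n + n) -> 'M[R]_(n + n))
    (gamma : 'cV[R]_(1 + 1) -> 'cV[R]_(n + n)) : Prop :=
  [/\ (forall z, unit_disc z -> U (gamma z)),
      (forall z, unit_disc z -> differentiable gamma z),
      (forall v z, unit_disc z -> {for z, continuous (fun w => 'd gamma w v)})
    & (forall z, unit_disc z -> forall v,
         'd gamma z (Jstd 1 *m v) = J (gamma z) *m 'd gamma z v)].

Definition partial_x {R : realType} {m : nat}
    (gamma : 'cV[R]_(1 + 1) -> 'cV[R]_m) : 'cV[R]_(1 + 1) -> 'cV[R]_m :=
  fun z => 'D_(delta_mx 0 0) gamma z.

(* The library derivative is total, hence the explicit requirement that all
   the iterated partial derivatives exist near 0. *)
Definition has_x_jet {R : realType} {m : nat}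
    (gamma : 'cV[R]_(1 + 1) -> 'cV[R]_m) (x : nat -> 'cV[R]_m) : Prop :=
  forall k : nat,
    (\forall z \near (0 : 'cV[R]_(1 + 1)),
       derivable (iter k partial_x gamma) z (delta_mx 0 0)) /\
    iter k partial_x gamma 0 = x k.

(* Main.v *)
(* Let h(z) = sum_k x_k z^k / k!, so that gamma must extend h from the real
   diameter. Writing z and its conjugate w as independent variables, a map
   gamma with values in R^m is J-holomorphic iff (J(gamma) + i) d_w gamma = 0.
   With J0 = J(0), E = J - J0 and the projection p = (1 - i J0)/2, it suffices
   to solve p (J(gamma) + i) d_w gamma = 0, that is
     p d_w gamma = (i/2) p E(gamma) d_w gamma,
   since J + J0 is invertible near 0. Let T f be the primitive of f in w which
   vanishes on the diagonal w = z. The equation and the boundary data become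
   the fixed point problem
     gamma = G + conj G,  G = p h + T ((i/2) p E(gamma) d_w gamma).
   No derivative in z is involved, and d_z T f is controlled by f and d_z f. So
   in the Banach algebra of series sum a_kl z^k w^l normed by
   sum (k+1)(l+1) |a_kl| the right-hand side is a contraction of a small ball,
   and the norm of h is exactly the quantity bounded by r. We iterate with J
   and h truncated to polynomials, so that all the iterates are polynomials in
   z and w; they converge in this norm, hence locally uniformly on the disc
   with all their derivatives. *)

Require Import Defs.
From HB Require Import structures.
From mathcomp Require Import all_boot all_order all_algebra.
From mathcomp Require Import all_classical all_reals all_analysis.
From mathcomp Require Import complex polyXY.
From mathcomp Require Import ring lra zify.
Set Implicit Arguments.
Unset Strict Implicit.
Unset Printing Implicit Defensive.
Import Order.TTheory GRing.Theory Num.Theory.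
Import numFieldNormedType.Exports.
Local Open Scope classical_set_scope.
Local Open Scope ring_scope.

(** * Weighted l1 norms on polynomials *)

(** The norm is shaped by two demands. The iteration differentiates in the conjugate variable w
    before taking a primitive: the weight l + 1 pays for the derivative, and [T] restores it at
    bounded cost because (l + 2) / (l + 1) <= 2. Adding the conjugate exchanges z and w, so z must
    carry the same weight; this is the origin of the factor k + 1 in the smallness condition on the
    jet.

    The map contracts because E(0) = 0: on a ball of radius R0 the factor E(gamma) has norm O(R0),
    and so has the Lipschitz constant.

    Only norms of polynomials occur; the completed algebra of series is never formed. The price is
    that each step has its own truncation of J and h, so that the successive distances satisfy
    d(N+1) <= d(N) / 2 + error(N). The errors are summable because they are bounded by the
    increments of bounded partial sums of positive series. *)

Record alg_norm (R : realFieldType) (A : nzRingType) (nu : A -> R) : Prop := AlgNorm {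
  alg_norm0 : nu 0 = 0;
  alg_norm1 : nu 1 = 1;
  alg_normN : forall a, nu (- a) = nu a;
  alg_normD : forall a b, nu (a + b) <= nu a + nu b;
  alg_normM : forall a b, nu (a * b) <= nu a * nu b }.

Section AlgNorm.
Variables (R : realFieldType) (A : nzRingType) (nu : A -> R).
Implicit Types p q : {poly A}.

Definition pnorm (w : nat -> R) p : R :=
  \sum_(i < size p) w i * nu p`_i.

Lemma pnormE w n p : nu 0 = 0 -> (size p <= n)%N -> pnorm w p = \sum_(i < n) w i * nu p`_i.
Proof.
move=> nu0 /subnKC <-; rewrite big_split_ord /= [X in _ + X]big1 ?addr0// => i _.
by rewrite nth_default ?leq_addr// nu0 mulr0.
Qed.

Hypothesis nuP : alg_norm nu.

Lemma alg_norm_ge0 a : 0 <= nu a.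
Proof.
have := alg_normD nuP a (- a); rewrite subrr (alg_norm0 nuP) (alg_normN nuP).
lra.
Qed.

Lemma alg_normB a b : nu (a - b) <= nu a + nu b.
Proof. by rewrite -(alg_normN nuP b); apply: alg_normD. Qed.

Lemma alg_norm_muln a k : nu (a *+ k) <= k%:R * nu a.
Proof.
elim: k => [|k IH]; first by rewrite mulr0n (alg_norm0 nuP) mul0r.
rewrite mulrS mulrSr mulrDl mul1r addrC.
by apply: le_trans (alg_normD nuP _ _) _; rewrite lerD2r.
Qed.

Lemma alg_norm_sum (I : Type) (r : seq I) (P : pred I) (F : I -> A) :
  nu (\sum_(i <- r | P i) F i) <= \sum_(i <- r | P i) nu (F i).
Proof.
elim/big_ind2: _ => [|x1 x2 y1 y2 h1 h2|//]; first by rewrite (alg_norm0 nuP).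
by apply: le_trans (alg_normD nuP _ _) _; apply: lerD.
Qed.

Lemma alg_norm_exp a t k : nu a <= t -> nu (a ^+ k) <= t ^+ k.
Proof.
move=> ha; elim: k => [|k IH]; first by rewrite !expr0 (alg_norm1 nuP).
rewrite !exprS; apply: le_trans (alg_normM nuP _ _) _.
by apply: ler_pM => //; apply: alg_norm_ge0.
Qed.

(** Submultiplicativity bounds the cost of multiplying by a power of ['X]; it is what makes
    [pnorm w] an algebra norm. *)
Definition weight (w : nat -> R) :=
  [/\ forall i, 0 <= w i, w 0%N = 1 & forall i j, w (i + j)%N <= w i * w j].


Lemma pnormC w c : weight w -> pnorm w c%:P = nu c.
Proof.
move=> [_ w0 _]; rewrite (@pnormE w 1%N) ?size_polyC_leq1 ?(alg_norm0 nuP)//.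
by rewrite big_ord1 coefC eqxx w0 mul1r.
Qed.

Lemma pnormMXn w p k : weight w -> pnorm w (p * 'X^k) <= w k * pnorm w p.
Proof.
move=> [w_ge0 w0 wD]; rewrite (@pnormE w (k + size p)%N _ (alg_norm0 nuP)); last first.
  by rewrite (leq_trans (size_polyMleq _ _))// size_polyXn addnC.
rewrite big_split_ord /= big1 => [|i _]; last first.
  by rewrite coefMXn ltn_ord (alg_norm0 nuP) mulr0.
rewrite add0r mulr_sumr; apply: ler_sum => i _.
rewrite coefMXn ltnNge leq_addr /= addKn mulrA.
by apply: ler_wpM2r (wD _ _); apply: alg_norm_ge0.
Qed.

Lemma pnormD w p q : weight w -> pnorm w (p + q) <= pnorm w p + pnorm w q.
Proof.
move=> [w_ge0 _ _]; have nu0 := alg_norm0 nuP; set n := maxn (size p) (size q).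
rewrite (@pnormE w n _ nu0 (size_polyD _ _)) (@pnormE w n p) ?leq_maxl//.
rewrite (@pnormE w n q) ?leq_maxr// -big_split; apply: ler_sum => i _ /=.
by rewrite -mulrDr coefD ler_wpM2l// (alg_normD nuP).
Qed.

Lemma pnormN w p : pnorm w (- p) = pnorm w p.
Proof.
by rewrite /pnorm size_polyN; apply: eq_bigr => i _; rewrite coefN (alg_normN nuP).
Qed.

Lemma pnorm0 w : pnorm w 0 = 0.
Proof. by rewrite /pnorm size_poly0 big_ord0. Qed.

Lemma pnormZ w c p : weight w -> pnorm w (c *: p) <= nu c * pnorm w p.
Proof.
move=> [w_ge0 _ _]; rewrite (pnormE w (alg_norm0 nuP) (size_scale_leq c p)) mulr_sumr.
apply: ler_sum => i _; rewrite coefZ mulrCA ler_wpM2l//; exact: alg_normM.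
Qed.

Lemma pnorm_sum w (I : Type) (r : seq I) (F : I -> {poly A}) : weight w ->
  pnorm w (\sum_(i <- r) F i) <= \sum_(i <- r) pnorm w (F i).
Proof.
move=> w_wt; elim/big_ind2: _ => [|x1 x2 y1 y2 h1 h2|//]; first by rewrite pnorm0.
by apply: le_trans (pnormD _ _ w_wt) _; apply: lerD.
Qed.

Lemma pnormM w p q : weight w -> pnorm w (p * q) <= pnorm w p * pnorm w q.
Proof.
move=> w_wt; have [w_ge0 _ _] := w_wt.
have pn_ge0 r : 0 <= pnorm w r.
  by apply: sumr_ge0 => i _; rewrite mulr_ge0// alg_norm_ge0.
rewrite -{1}(coefK p) poly_def mulr_suml.
apply: le_trans (pnorm_sum _ _ w_wt) _.
rewrite [X in _ <= X * _]/pnorm mulr_suml; apply: ler_sum => i _.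
rewrite -scalerAl -commr_polyXn; apply: le_trans (pnormZ _ _ w_wt) _.
rewrite [w i * _]mulrC -mulrA ler_wpM2l ?alg_norm_ge0//; exact: pnormMXn.
Qed.

Lemma pnorm_alg_norm w : weight w -> alg_norm (pnorm w).
Proof.
move=> w_wt; split=> [||p|p q|p q]; first exact: pnorm0.
- by rewrite pnormC// (alg_norm1 nuP).
- exact: pnormN.
- exact: pnormD.
- exact: pnormM.
Qed.

Lemma le_pnorm w w' p :
  (forall i, w i <= w' i) -> pnorm w p <= pnorm w' p.
Proof.
by move=> le_w; apply: ler_sum => i _; rewrite ler_wpM2r ?alg_norm_ge0.
Qed.

End AlgNorm.

Lemma weight1 (R : realFieldType) : weight (fun _ => 1 : R).
Proof. by split=> // i j; rewrite mulr1. Qed.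

Lemma weightS (R : realFieldType) : weight (fun k => k.+1%:R : R).
Proof.
split=> // i j; rewrite -natrM ler_nat; lia.
Qed.

Lemma weightX (R : realFieldType) (s : R) : 0 <= s -> weight (fun k => s ^+ k).
Proof. by move=> s_ge0; split=> [i||i j]; rewrite ?exprn_ge0 ?expr0 ?exprD. Qed.

Lemma normc_alg_norm (R : rcfType) : alg_norm (@Normc.normc R).
Proof.
split=> [||a|a b|a b].
- exact: Normc.normc0.
- exact: Normc.normc1.
- exact: normcN.
- exact: le_normcD.
- by rewrite Normc.normcM.
Qed.

Local Open Scope complex_scope.

(** * Polynomials in z and its conjugate *)

(* In [{poly {poly A}}] the inner variable ['X%:P] is z and the outer variable
   ['X] its conjugate. *)
Section BivariateRing.
Variable A : comNzRingType.
Implicit Types p q : {poly {poly A}}.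

(** The restriction to the real diameter, where z equals its conjugate. *)
Definition diag p : {poly A} := p.['X].

Lemma diag_swap p : diag (swapXY p) = diag p.
Proof.
rewrite /diag -{1}(coefK p) poly_def rmorph_sum horner_sum horner_coef.
apply: eq_bigr => i _; rewrite -mul_polyC rmorphM rmorphXn /= swapXY_X swapXY_polyC.
rewrite hornerM horner_exp hornerC; congr (_ * _).
by elim/poly_ind: (p`_i) => [|r c IH]; rewrite ?rmorph0 ?horner0// rmorphD rmorphM /=
  map_polyX map_polyC /= hornerD hornerM IH hornerX hornerC.
Qed.

Definition dz p := swapXY (swapXY p)^`().

Lemma dzD p q : dz (p + q) = dz p + dz q.
Proof. by rewrite /dz raddfD derivD raddfD. Qed.

Lemma dzB p q : dz (p - q) = dz p - dz q.
Proof. by rewrite /dz raddfB derivB raddfB. Qed.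

Lemma dz0 : dz 0 = 0.
Proof. by have := dzB 0 0; rewrite !subrr. Qed.

Lemma swapXYM p q : swapXY (p * q) = swapXY p * swapXY q.
Proof. exact: rmorphM. Qed.

Lemma dzM p q : dz (p * q) = dz p * q + p * dz q.
Proof. by rewrite /dz swapXYM derivM raddfD /= !swapXYM !swapXYK. Qed.

Lemma dzX : dz 'X = 0.
Proof. by rewrite /dz swapXY_X derivC raddf0. Qed.

Lemma dzC (c : {poly A}) : dz c%:P = (c^`())%:P.
Proof. by rewrite /dz swapXY_polyC deriv_map swapXY_map_polyC. Qed.

Definition dx p := dz p + p^`().

Lemma dxB p q : dx (p - q) = dx p - dx q.
Proof. by rewrite /dx dzB derivB; ring. Qed.

(** Reduces x-derivatives on the real axis to derivatives of a polynomial in one variable, from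
    which the jet at 0 is read. *)
Lemma diag_dx p : diag (dx p) = (diag p)^`().
Proof.
rewrite /dx; elim/poly_ind: p => [|p c IH].
  by rewrite /diag /dz !(raddf0, deriv0, add0r, horner0).
rewrite dzD dzM dzX dzC derivD derivM derivX derivC.
rewrite mulr0 !addr0 mulr1; move: IH; rewrite /diag => IH.
rewrite !(hornerD, hornerMX, hornerC) derivD derivM derivX mulr1 -IH hornerD.
by rewrite mulrDl; ring.
Qed.

End BivariateRing.

Section Bivariate.
Variable R : rcfType.
Local Notation C := (R[i]).
Local Notation normc := (@Normc.normc R).
Implicit Types p q : {poly {poly C}}.

Definition pnorm2 (w w' : nat -> R) p := pnorm (pnorm normc w') w p.

Lemma pnorm_normc_alg_norm (w : nat -> R) : weight w -> alg_norm (pnorm normc w).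
Proof. by move=> hw; apply: (pnorm_alg_norm (normc_alg_norm R) hw). Qed.

Lemma pnorm2_alg_norm (w w' : nat -> R) : weight w -> weight w' ->
  alg_norm (pnorm2 w w').
Proof.
by move=> hw hw'; apply: pnorm_alg_norm hw; apply: pnorm_normc_alg_norm.
Qed.

Lemma pnorm2E w w' n p : (size p <= n)%N -> (sizeY p <= n)%N ->
  pnorm2 w w' p = \sum_(i < n) \sum_(j < n) w i * w' j * normc p`_i`_j.
Proof.
move=> pn pYn; rewrite /pnorm2 (pnormE w _ pn) ?pnorm0//.
apply: eq_bigr => i _; rewrite (pnormE w' (Normc.normc0 R) (n := n)).
  by rewrite mulr_sumr; apply: eq_bigr => j _; rewrite mulrA.
have [lip|lpi] := ltnP i (size p); last by rewrite nth_default// size_poly0.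
by apply: leq_trans pYn; apply: (max_size_coefXY p (Ordinal lip)).
Qed.

Lemma pnorm2_swap w p : pnorm2 w w (swapXY p) = pnorm2 w w p.
Proof.
set n := maxn (maxn (size p) (sizeY p)) (maxn (size (swapXY p)) (sizeY (swapXY p))).
rewrite !(@pnorm2E _ _ n); try by rewrite !leq_max leqnn ?orbT.
rewrite exchange_big /=; apply: eq_bigr => i _; apply: eq_bigr => j _.
by rewrite coef_swapXY [w j * _]mulrC.
Qed.

Lemma normcJ_real (z : C) : normc z^* = normc z.
Proof. by case: z => a b /=; rewrite sqrrN. Qed.

(** Conjugation of functions, carried out on coefficients (see [ev_sigma]); a fixed point is
    real-valued. *)
Definition sigma p := swapXY (map_poly (map_poly (@conjc R)) p).

Lemma coef_sigma p i j : (sigma p)`_i`_j = (p`_j`_i)^*.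
Proof. by rewrite coef_swapXY !coef_map. Qed.

Lemma sigmaD p q : sigma (p + q) = sigma p + sigma q.
Proof. by rewrite /sigma !rmorphD. Qed.

Lemma sigmaB p q : sigma (p - q) = sigma p - sigma q.
Proof.
apply/polyP => i; apply/polyP => j.
by rewrite !(coefB, coef_sigma) rmorphB.
Qed.

Lemma sigmaM p q : sigma (p * q) = sigma p * sigma q.
Proof. by rewrite /sigma !rmorphM. Qed.

Lemma sigmaK : involutive sigma.
Proof.
by move=> p; apply/polyP => i; apply/polyP => j; rewrite !coef_sigma conjcK.
Qed.

Lemma sigma_polyC (c : C) : sigma c%:P%:P = (c^*)%:P%:P.
Proof.
by rewrite /sigma map_polyC /= map_polyC swapXY_polyC map_polyC. Qed.

Lemma pnorm2_sigma w p : pnorm2 w w (sigma p) = pnorm2 w w p.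
Proof.
set n := maxn (maxn (size p) (sizeY p)) (maxn (size (sigma p)) (sizeY (sigma p))).
rewrite !(@pnorm2E _ _ n); try by rewrite !leq_max leqnn ?orbT.
rewrite exchange_big /=; apply: eq_bigr => i _; apply: eq_bigr => j _.
by rewrite coef_sigma normcJ_real [w j * _]mulrC.
Qed.

Definition ev (z : C) p : C := p.[z^*, z].

HB.instance Definition _ z :=
  GRing.RMorphism.copy (ev z) (horner_eval z \o horner_eval (z^*)%:P).

Lemma evB z p q : ev z (p - q) = ev z p - ev z q.
Proof. exact: rmorphB. Qed.

Lemma evD z p q : ev z (p + q) = ev z p + ev z q.
Proof. exact: rmorphD. Qed.

Lemma evM z p q : ev z (p * q) = ev z p * ev z q.
Proof. exact: rmorphM. Qed.

Lemma ev0 z : ev z 0 = 0.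
Proof. by rewrite /ev !horner0. Qed.

Lemma ev_polyC z c : ev z c%:P%:P = c.
Proof. by rewrite /ev !hornerC. Qed.

Lemma ev1 z : ev z 1 = 1.
Proof. exact: ev_polyC. Qed.

Lemma ev_X z : ev z 'X = z^*.
Proof. by rewrite /ev hornerX hornerC. Qed.

Lemma ev_Y z : ev z 'X%:P = z.
Proof. by rewrite /ev hornerC hornerX. Qed.

Lemma ev_sigma z p : ev z (sigma p) = (ev z p)^*.
Proof.
rewrite /ev /sigma horner2_swapXY -{1}(conjcK z).
rewrite -[in LHS](map_polyC (@conjc R)) /= horner_map horner_map /=.
by [].
Qed.

Lemma diag_sigma p : diag (sigma p) = map_poly (@conjc R) (diag p).
Proof.
by rewrite /sigma diag_swap /diag -[in LHS](map_polyX (@conjc R)) horner_map.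
Qed.

Lemma ev_diag t p : ev t%:C p = (diag p).[t%:C].
Proof.
rewrite /ev /diag; elim/poly_ind: p => [|p c IH]; first by rewrite !horner0.
rewrite !hornerMXaddC !hornerD hornerMX hornerM hornerC -IH /=.
by congr (_ * _ + _); apply/eqP; rewrite eq_complex /= oppr0 !eqxx.
Qed.

End Bivariate.

(** * Inversion of d_w with zero values on the diagonal *)

Section Primitive.
Variable F : numFieldType.
Implicit Types p q : {poly {poly F}}.

(* The coefficient of index 0 vanishes because [0^-1 = 0]. *)
Definition prim p : {poly {poly F}} :=
  \poly_(i < (size p).+1) ((i%:R^-1)%:P * p`_i.-1).

Lemma coef_prim p i : (prim p)`_i = (i%:R^-1)%:P * p`_i.-1.
Proof.
rewrite coef_poly; case: i => [|i /=]; first by rewrite invr0 polyC0 mul0r.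
by rewrite ltnS; case: ltnP => // pi; rewrite nth_default// mulr0.
Qed.

Lemma primB p q : prim (p - q) = prim p - prim q.
Proof. by apply/polyP => i; rewrite !(coefB, coef_prim) mulrBr. Qed.

Lemma primCM c p : prim (c%:P%:P * p) = c%:P%:P * prim p.
Proof. by apply/polyP => i; rewrite !(coefCM, coef_prim) mulrCA. Qed.

Lemma deriv_prim p : (prim p)^`() = p.
Proof.
apply/polyP => i; rewrite coef_deriv coef_prim /= -mulrnAl -polyCMn.
by rewrite -[_^-1 *+ _]mulr_natl mulfV ?pnatr_eq0// mul1r.
Qed.

(** The operator [T] of the overview. The subtracted term depends on z alone, so it does not affect
    the derivative in the conjugate variable. *)
Definition dbar_inv p := prim p - (diag (prim p))%:P.

Lemma dbar_invB p q : dbar_inv (p - q) = dbar_inv p - dbar_inv q.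
Proof. by rewrite /dbar_inv primB /diag hornerD hornerN polyCB; ring. Qed.

Lemma dbar_inv0 : dbar_inv 0 = 0.
Proof. by have := dbar_invB 0 0; rewrite !subrr. Qed.

Lemma dbar_invCM c p : dbar_inv (c%:P%:P * p) = c%:P%:P * dbar_inv p.
Proof. by rewrite /dbar_inv primCM /diag hornerM hornerC polyCM; ring. Qed.

Lemma dbar_invN p : dbar_inv (- p) = - dbar_inv p.
Proof. by rewrite -sub0r dbar_invB dbar_inv0 sub0r. Qed.

Lemma dbar_invD p q : dbar_inv (p + q) = dbar_inv p + dbar_inv q.
Proof. by rewrite -{1}[q]opprK dbar_invB dbar_invN opprK. Qed.

Lemma dbar_inv_sum (I : Type) (r : seq I) (f : I -> {poly {poly F}}) :
  dbar_inv (\sum_(i <- r) f i) = \sum_(i <- r) dbar_inv (f i).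
Proof.
elim: r => [|i r IH]; first by rewrite !big_nil dbar_inv0.
by rewrite !big_cons dbar_invD IH.
Qed.

Lemma deriv_dbar_inv p : (dbar_inv p)^`() = p.
Proof. by rewrite /dbar_inv derivB derivC subr0 deriv_prim. Qed.

Lemma diag_dbar_inv p : diag (dbar_inv p) = 0.
Proof. by rewrite /diag /dbar_inv hornerD hornerN hornerC subrr. Qed.

End Primitive.

Section Norms.
Variable R : rcfType.
Local Notation C := (R[i]).
Local Notation normc := (@Normc.normc R).
Implicit Types p q : {poly {poly C}}.

Local Notation wS := (fun k => k.+1%:R : R).
Local Notation w1 := (fun=> 1 : R).

(** The digits are the exponents of the weights, first for the conjugate variable, then for z.
    [norm01] measures what has lost one derivative in the conjugate variable. *)
Definition norm11 p : R := pnorm2 wS wS p.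
Definition norm01 p : R := pnorm2 w1 wS p.

Lemma norm11P : alg_norm norm11.
Proof. exact: pnorm2_alg_norm (@weightS R) (@weightS R). Qed.

Lemma norm01P : alg_norm norm01.
Proof. exact: pnorm2_alg_norm (@weight1 R) (@weightS R). Qed.

Lemma norm11_CC c : norm11 c%:P%:P = normc c.
Proof.
rewrite /norm11 /pnorm2 pnormC; [|exact/pnorm_normc_alg_norm/weightS|exact: weightS].
by rewrite pnormC; [|exact: normc_alg_norm|exact: weightS].
Qed.

Lemma le_norm01 p : norm01 p <= norm11 p.
Proof.
apply: le_pnorm => [|i]; first exact/pnorm_normc_alg_norm/weightS.
by rewrite ler1n.
Qed.

Lemma norm11_sigma p : norm11 (sigma p) = norm11 p.
Proof. exact: pnorm2_sigma. Qed.

(** The factor [i + 1] produced by differentiating the power [i + 1] is absorbed by the weight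
    [i + 2] of that power. *)
Lemma norm01_deriv p : norm01 p^`() <= norm11 p.
Proof.
have nuP := pnorm_normc_alg_norm (@weightS R).
have nu0 := alg_norm0 nuP.
rewrite /norm01 /norm11 /pnorm2 (@pnormE _ _ _ _ (size p) _ nu0); last first.
  by rewrite (leq_trans (size_poly _ _)) ?leq_pred.
rewrite (@pnormE _ _ _ _ (size p).+1 p nu0)//.
rewrite big_ord_recl /= ler_wpDl ?mulr_ge0 ?(alg_norm_ge0 nuP)//.
apply: ler_sum => i _; rewrite mul1r coef_deriv /bump /= ?add1n.
rewrite -[_ *+ _]mulr_natl; apply: le_trans (alg_normM nuP _ _) _.
apply: ler_wpM2r; first exact: alg_norm_ge0 nuP _.
have -> : i.+1%:R = (i.+1%:R : C)%:P by rewrite rmorph_nat.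
rewrite pnormC; [|exact: normc_alg_norm|exact: weightS].
by rewrite normcMn Normc.normc1 ler_nat.
Qed.

(** The power [i] becomes the power [i + 1] divided by [i + 1]; its weight [i + 2] leaves a ratio of
    at most 2. *)
Lemma norm11_prim p : norm11 (prim p) <= 2 * norm01 p.
Proof.
have nuP := pnorm_normc_alg_norm (@weightS R).
have nu0 := alg_norm0 nuP.
rewrite /norm01 /norm11 /pnorm2 (@pnormE _ _ _ _ (size p).+1 _ nu0) ?size_poly//.
rewrite big_ord_recl coef_prim invr0 polyC0 mul0r nu0 mulr0 add0r mulr_sumr.
apply: ler_sum => i _; rewrite mul1r coef_prim /bump /= ?add1n.
apply: (@le_trans _ _ (i.+2%:R * ((i.+1%:R)^-1 * pnorm normc wS p`_i))).
  apply: ler_wpM2l => //; apply: le_trans (alg_normM nuP _ _) _.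
  rewrite pnormC; [|exact: normc_alg_norm|exact: weightS].
  by rewrite Normc.normcV normcMn Normc.normc1.
rewrite mulrA ler_wpM2r ?(alg_norm_ge0 nuP)// ler_pdivrMr// -natrM ler_nat.
lia.
Qed.

(** On the diagonal the power [i + 1] of the conjugate variable turns into a power of z, which costs
    a factor [i + 2] again; the coefficient of the primitive compensates it as before. *)
Lemma norm11_diag_prim p : norm11 (diag (prim p))%:P <= 2 * norm01 p.
Proof.
have nuP := pnorm_normc_alg_norm (@weightS R).
rewrite /norm01 /norm11 /pnorm2 pnormC//; last exact: weightS.
rewrite /diag (horner_coef_wide _ (size_poly _ _)).
apply: le_trans (alg_norm_sum nuP _ _ _) _.
rewrite big_ord_recl coef_prim invr0 polyC0 mul0r mul0r (alg_norm0 nuP) add0r.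
rewrite mulr_sumr; apply: ler_sum => i _; rewrite mul1r coef_prim /bump /= ?add1n.
apply: (@le_trans _ _ (i.+2%:R * ((i.+1%:R)^-1 * pnorm normc wS p`_i))).
  rewrite mulrC; apply: le_trans (alg_normM nuP _ _) _; apply: ler_pM.
  - exact: alg_norm_ge0 nuP _.
  - exact: alg_norm_ge0 nuP _.
  - rewrite -[X in pnorm _ _ X]mul1r.
    apply: le_trans (pnormMXn (normc_alg_norm R) _ _ (@weightS R)) _.
    by rewrite (alg_norm1 nuP) mulr1.
  - apply: le_trans (alg_normM nuP _ _) _.
    rewrite pnormC; [|exact: normc_alg_norm|exact: weightS].
    by rewrite Normc.normcV normcMn Normc.normc1.
rewrite mulrA ler_wpM2r ?(alg_norm_ge0 nuP)// ler_pdivrMr// -natrM ler_nat.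
lia.
Qed.

Lemma norm11_dbar_inv p : norm11 (dbar_inv p) <= 4 * norm01 p.
Proof.
apply: le_trans (alg_normB norm11P _ _) _.
have := norm11_prim p; have := norm11_diag_prim p; lra.
Qed.

End Norms.

(** * Substitution in a power series *)

Section BoxSums.
Variables (R : realFieldType) (A : comNzRingType) (nu : A -> R) (emb : R -> A).
Hypothesis nuP : alg_norm nu.
Hypothesis nu_emb : forall a, nu (emb a) = `|a|.
Variable m : nat.
Implicit Types (c : {ffun 'I_m -> nat} -> R) (g h : 'I_m -> A).

(** The ring is arbitrary because these sums are taken both at polynomials, in the iteration, and at
    real points, where they converge to the entries of [J]. *)
Definition box_sum c N g : A :=
  \sum_(beta : {ffun 'I_m -> 'I_N})
    emb (c (box_index beta)) * \prod_i g i ^+ box_index beta i.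

Definition box_norm c (rho : R) N : R :=
  \sum_(beta : {ffun 'I_m -> 'I_N})
    `|c (box_index beta)| * rho ^+ (\sum_i box_index beta i)%N.

Lemma alg_norm_monomial g (alpha : 'I_m -> nat) tau :
  (forall i, nu (g i) <= tau) ->
  nu (\prod_i g i ^+ alpha i) <= tau ^+ (\sum_i alpha i)%N.
Proof.
move=> g_tau; have nu_ge0 := alg_norm_ge0 nuP.
elim/big_ind2: _ => [|x k y l hx hy|i _].
- by rewrite expr0 (alg_norm1 nuP).
- by rewrite exprD; apply: le_trans (alg_normM nuP _ _) _; apply: ler_pM.
- exact: alg_norm_exp.
Qed.

(* Both sides are multiplied by [tau] to avoid the exponent [|alpha| - 1]. *)
Lemma monomial_lipschitz g h (alpha : 'I_m -> nat) tau :
  (forall i, nu (g i) <= tau) -> (forall i, nu (h i) <= tau) ->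
  nu (\prod_i g i ^+ alpha i - \prod_i h i ^+ alpha i) * tau <=
  (\sum_i alpha i)%N%:R * tau ^+ (\sum_i alpha i)%N * \sum_i nu (g i - h i).
Proof.
move=> g_tau h_tau; have nu_ge0 := alg_norm_ge0 nuP.
set delta := \sum_i nu _.
have delta_ge0 : 0 <= delta by apply: sumr_ge0.
(* [Q a b k]: [a] and [b] behave like monomials of degree [k]. This is stable under products, by a
   a' - b b' = (a - b) a' + b (a' - b'). *)
pose Q (a b : A) k := [/\ nu a <= tau ^+ k, nu b <= tau ^+ k &
  nu (a - b) * tau <= k%:R * tau ^+ k * delta].
have Q1 : Q 1 1 0%N.
  by split; rewrite ?expr0 ?(alg_norm1 nuP)// subrr (alg_norm0 nuP) !mul0r.
have QM a b k a' b' k' : 0 <= tau -> Q a b k -> Q a' b' k' ->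
    Q (a * a') (b * b') (k + k')%N.
  move=> tau_ge0 [ak bk abk] [ak' bk' abk']; split.
  - by rewrite exprD; apply: le_trans (alg_normM nuP _ _) _; apply: ler_pM.
  - by rewrite exprD; apply: le_trans (alg_normM nuP _ _) _; apply: ler_pM.
  - have -> : a * a' - b * b' = (a - b) * a' + b * (a' - b') by ring.
    apply: (@le_trans _ _ ((nu (a - b) * tau) * nu a' + nu b * (nu (a' - b') * tau))).
      rewrite mulrAC [nu b * _]mulrA -mulrDl ler_wpM2r//.
      apply: le_trans (alg_normD nuP _ _) _.
      by apply: lerD; apply: alg_normM nuP _ _.
    have -> : (k + k')%:R * tau ^+ (k + k') * delta =
       (k%:R * tau ^+ k * delta) * tau ^+ k' + tau ^+ k * (k'%:R * tau ^+ k' * delta).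
      by rewrite exprD natrD; ring.
    by apply: lerD; apply: ler_pM => //; rewrite ?mulr_ge0.
have Qexp i k : 0 <= tau -> Q (g i ^+ k) (h i ^+ k) k.
  move=> tau_ge0; elim: k => [|k IH]; first by rewrite !expr0.
  rewrite !exprS -add1n; apply: QM IH => //; split; rewrite ?expr1 ?mul1r//.
  rewrite mulrC ler_wpM2l// /delta (bigD1 i)//= lerDl.
  by apply: sumr_ge0.
(* Without variables nothing makes [tau] nonnegative, but both monomials are then 1. *)
have [m0|m_gt0] := posnP m.
  have sum0 : (\sum_i alpha i = 0)%N.
    by apply: big1 => i _; have := ltn_ord i; rewrite [X in (_ < X)%N]m0.
  have prod0 (f : 'I_m -> A) : \prod_i f i ^+ alpha i = 1.
    by apply: big1 => i _; have := ltn_ord i; rewrite [X in (_ < X)%N]m0.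
  by rewrite !prod0 subrr (alg_norm0 nuP) sum0 !mul0r.
have tau_ge0 : 0 <= tau by apply: le_trans (g_tau (Ordinal m_gt0)).
suff [] : Q (\prod_i g i ^+ alpha i) (\prod_i h i ^+ alpha i) (\sum_i alpha i)%N.
  by [].
elim/big_ind3: _ => // *; [exact: QM|exact: Qexp].
Qed.

(** A Cauchy estimate from radius [rho] to [rho / 2]: a monomial of degree [k] contributes k (rho /
    2)^(k - 1), which is at most (2 / rho) rho^k since k <= 2^k. *)
Lemma box_sum_lipschitz c N g h rho : 0 < rho ->
  (forall i, nu (g i) <= rho / 2) -> (forall i, nu (h i) <= rho / 2) ->
  nu (box_sum c N g - box_sum c N h) <=
  2 / rho * box_norm c rho N * \sum_i nu (g i - h i).
Proof.
move=> rho_gt0 g_rho h_rho; have nu_ge0 := alg_norm_ge0 nuP.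
rewrite /box_sum -sumrB; apply: le_trans (alg_norm_sum nuP _ _ _) _.
set d := \sum_i nu (g i - h i); rewrite /box_norm mulrAC mulr_sumr; apply: ler_sum => beta _.
rewrite -mulrBr; apply: le_trans (alg_normM nuP _ _) _; rewrite nu_emb.
rewrite [2 / rho * _ * _]mulrCA ler_wpM2l//.
have tau_gt0 : 0 < rho / 2 by rewrite divr_gt0.
rewrite -(ler_pM2r tau_gt0).
apply: le_trans (monomial_lipschitz (box_index beta) g_rho h_rho) _.
rewrite -/d; set k := (\sum_i _)%N.
have d_ge0 : 0 <= d by apply: sumr_ge0.
have -> : 2 / rho * d * rho ^+ k * (rho / 2) = rho ^+ k * d.
  by field; rewrite gt_eqF.
rewrite ler_wpM2r// expr_div_n mulrCA ler_piMr ?exprn_ge0 ?(ltW rho_gt0)//.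
by rewrite ler_pdivrMr ?exprn_gt0// mul1r -natrX ler_nat ltnW// ltn_expl.
Qed.

Lemma sum_box_widen (V : nmodType) N (F : {ffun 'I_m -> nat} -> V) :
  \sum_(beta : {ffun 'I_m -> 'I_N}) F (box_index beta) =
  \sum_(beta : {ffun 'I_m -> 'I_N.+1} | [forall i, beta i < N]%N) F (box_index beta).
Proof.
pose w (beta : {ffun 'I_m -> 'I_N}) : {ffun 'I_m -> 'I_N.+1} :=
  [ffun i => widen_ord (leqnSn N) (beta i)].
have w_inj : injective w.
  move=> b b' /ffunP bb'; apply/ffunP => i; have := bb' i; rewrite !ffunE.
  by move=> /(congr1 val) /= bi; apply: val_inj.
have Fw beta : F (box_index beta) = F (box_index (w beta)).
  by congr F; apply/ffunP => i; rewrite !ffunE.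
rewrite (eq_bigr _ (fun beta _ => Fw beta)).
rewrite -(@big_imset _ 0 +%R _ _ w predT
  (fun beta => F (box_index beta))) /=; last by move=> b b' _ _; apply: w_inj.
apply: eq_bigl => beta; apply/imsetP/forallP => [[b _ ->] i|beta_lt].
  by rewrite !ffunE /= ltn_ord.
exists [ffun i => Ordinal (beta_lt i)] => //.
by apply/ffunP => i; rewrite !ffunE; apply: val_inj.
Qed.

Lemma sum_box_step (V : zmodType) N (F : {ffun 'I_m -> nat} -> V) :
  \sum_(beta : {ffun 'I_m -> 'I_N.+1}) F (box_index beta) -
  \sum_(beta : {ffun 'I_m -> 'I_N}) F (box_index beta) =
  \sum_(beta : {ffun 'I_m -> 'I_N.+1} | ~~ [forall i, beta i < N]%N)
    F (box_index beta).
Proof.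
rewrite (sum_box_widen N F).
rewrite (bigID (fun beta : {ffun 'I_m -> 'I_N.+1} => [forall i, beta i < N]%N)) /=.
by rewrite addrAC subrr add0r.
Qed.

(** Only multi-indices with an entry equal to [N] are new, and the same shell of the majorant bounds
    their terms. The bound telescopes in [N], whence summable truncation errors. *)
Lemma box_sum_step c N g rho : (forall i, nu (g i) <= rho) ->
  nu (box_sum c N.+1 g - box_sum c N g) <= box_norm c rho N.+1 - box_norm c rho N.
Proof.
move=> g_rho; rewrite /box_sum.
rewrite (sum_box_step N (fun alpha => emb (c alpha) * \prod_i g i ^+ alpha i)).
rewrite /box_norm (sum_box_step N (fun alpha => `|c alpha| * rho ^+ (\sum_i alpha i)%N)).
apply: le_trans (alg_norm_sum nuP _ _ _) _; apply: ler_sum => beta _.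
apply: le_trans (alg_normM nuP _ _) _; rewrite nu_emb ler_wpM2l//.
exact: alg_norm_monomial.
Qed.

End BoxSums.

(** * The iteration *)

Section Iteration.
Variables (R : rcfType) (m : nat).
Local Notation P := {poly {poly R[i]}}.
Local Notation normc := (@Normc.normc R).
Variables (Q : 'M[R[i]]_m) (e : nat -> 'I_m -> 'I_m -> ('I_m -> P) -> P).
Variable hh : nat -> 'I_m -> P.
Implicit Types g : 'I_m -> P.

Definition dist11 g g' : R := \sum_i norm11 (g i - g' i).

(** In the notation of the overview, [field_term] is an entry of E(gamma) d_w gamma, [half_step] is
    [G] and [step] is G + conj G, with data truncated at order [N]. *)
Definition field_term N g j : P := \sum_k e N j k g * (g k)^`().

Definition half_step N g i : P :=
  hh N i + dbar_inv (\sum_j (Q i j)%:P%:P * field_term N g j).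

Definition step N g i : P := half_step N g i + sigma (half_step N g i).

(** [iteri] passes its index to [step], so [iterate N.+1] is [step N (iterate N)]: the order of
    truncation grows with the iteration. *)
Definition iterate N : 'I_m -> P := iteri N step (fun=> 0).

Let norm11_ge0 p : 0 <= norm11 p := alg_norm_ge0 (norm11P R) p.
Let norm01_ge0 p : 0 <= norm01 p := alg_norm_ge0 (norm01P R) p.

Lemma dist11_ge0 g g' : 0 <= dist11 g g'.
Proof. by apply: sumr_ge0 => i _. Qed.

Lemma le_dist11 g g' i : norm11 (g i - g' i) <= dist11 g g'.
Proof. by rewrite /dist11 (bigD1 i)//= lerDl sumr_ge0. Qed.

Lemma dist11_trans g g' g'' : dist11 g g'' <= dist11 g g' + dist11 g' g''.
Proof.
rewrite /dist11 -big_split /=; apply: ler_sum => i _.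
have -> : g i - g'' i = (g i - g' i) + (g' i - g'' i) by ring.
exact: alg_normD (norm11P R) _ _.
Qed.

Let kappa : R := \sum_i \sum_j normc (Q i j).

Let normc_ge0 (z : R[i]) : 0 <= normc z := alg_norm_ge0 (normc_alg_norm R) z.

Let kappa_ge0 : 0 <= kappa.
Proof. by apply: sumr_ge0 => i _; apply: sumr_ge0 => j _. Qed.

Lemma sum_norm11_dbar_inv (K : 'I_m -> P) :
  \sum_i norm11 (dbar_inv (\sum_j (Q i j)%:P%:P * K j)) <=
  4 * kappa * \sum_j norm01 (K j).
Proof.
have -> : 4 * kappa * \sum_j norm01 (K j) =
    \sum_i \sum_j 4 * (normc (Q i j) * \sum_k norm01 (K k)).
  rewrite -mulrA /kappa mulr_suml mulr_sumr; apply: eq_bigr => i _.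
  by rewrite mulr_suml mulr_sumr.
apply: ler_sum => i _; rewrite dbar_inv_sum.
apply: le_trans (alg_norm_sum (norm11P R) _ _ _) _; apply: ler_sum => j _.
rewrite dbar_invCM; apply: le_trans (alg_normM (norm11P R) _ _) _.
rewrite norm11_CC mulrCA ler_wpM2l//; apply: le_trans (norm11_dbar_inv _) _.
by rewrite ler_wpM2l// (bigD1 j)//= lerDl sumr_ge0.
Qed.

(** One estimate for two uses: the contraction when [N = N'], the effect of a new truncation when
    [g = g']. In the constant 8, a factor 2 comes from adding the conjugate and 4 from
    [norm11_dbar_inv]. *)
Lemma dist11_step N N' g g' :
  dist11 (step N g) (step N' g') <=
  2 * dist11 (hh N) (hh N') +
  8 * kappa * \sum_j \sum_k (norm11 (e N j k g - e N' j k g') * norm11 (g k) +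
     norm11 (e N' j k g') * norm11 (g k - g' k)).
Proof.
pose D i := half_step N g i - half_step N' g' i.
have stepE i : step N g i - step N' g' i = D i + sigma (D i).
  by rewrite /step /D sigmaB opprD addrACA.
apply: (@le_trans _ _ (2 * \sum_i norm11 (D i))).
  rewrite mulr_sumr; apply: ler_sum => i _; rewrite stepE.
  by apply: le_trans (alg_normD (norm11P R) _ _) _; rewrite norm11_sigma; lra.
have DE i : D i = (hh N i - hh N' i) +
    dbar_inv (\sum_j (Q i j)%:P%:P * (field_term N g j - field_term N' g' j)).
  rewrite /D /half_step.
  under [X in _ = _ + dbar_inv X]eq_bigr do rewrite mulrBr.
  by rewrite sumrB dbar_invB; ring.
have -> : 8 * kappa = 2 * (4 * kappa) by ring.
rewrite -mulrA -mulrDr ler_wpM2l//.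
apply: le_trans (_ : \sum_i norm11 (D i) <= dist11 (hh N) (hh N') + 4 * kappa *
    \sum_j norm01 (field_term N g j - field_term N' g' j)) _.
  apply: le_trans (lerD (lexx _) (sum_norm11_dbar_inv _)).
  rewrite /dist11 -big_split /=; apply: ler_sum => i _; rewrite DE.
  exact: alg_normD (norm11P R) _ _.
rewrite lerD2l ler_wpM2l ?mulr_ge0//; apply: ler_sum => j _.
rewrite /field_term -sumrB; apply: le_trans (alg_norm_sum (norm01P R) _ _ _) _.
apply: ler_sum => k _.
have -> : e N j k g * (g k)^`() - e N' j k g' * (g' k)^`() =
    (e N j k g - e N' j k g') * (g k)^`() + e N' j k g' * (g k - g' k)^`().
  by rewrite derivB; ring.
apply: le_trans (alg_normD (norm01P R) _ _) _.
by apply: lerD; (apply: le_trans (alg_normM (norm01P R) _ _) _; apply: ler_pM;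
  rewrite ?le_norm01 ?norm01_deriv).
Qed.

Variables (rho L R0 : R) (a : nat -> R).
Hypotheses (L_ge0 : 0 <= L) (R0_ge0 : 0 <= R0) (R0_rho : R0 <= rho).
Hypothesis e_lipschitz : forall N j k g g',
  (forall i, norm11 (g i) <= rho) -> (forall i, norm11 (g' i) <= rho) ->
  norm11 (e N j k g - e N j k g') <= L * dist11 g g'.
Hypothesis e_0 : forall N j k, e N j k (fun=> 0) = 0.
Hypothesis e_step : forall N j k g, (forall i, norm11 (g i) <= rho) ->
  norm11 (e N.+1 j k g - e N j k g) <= a N.
Hypothesis R0_small : 16 * kappa * m%:R * L * R0 <= 2^-1.
Hypothesis hh_small : forall N, dist11 (hh N) (fun=> 0) <= R0 / 4.

Local Notation ball g := (dist11 g (fun=> 0) <= R0).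

Let ball_rho g : ball g -> forall i, norm11 (g i) <= rho.
Proof.
move=> g_R0 i; apply: le_trans R0_rho; apply: le_trans g_R0.
by have := le_dist11 g (fun=> 0) i; rewrite subr0.
Qed.

Let sum_norm11_ball g : ball g -> \sum_k norm11 (g k) <= R0.
Proof. by rewrite /dist11; under eq_bigr do rewrite subr0. Qed.

Let sum_norm11E g : dist11 g (fun=> 0) = \sum_k norm11 (g k).
Proof. by rewrite /dist11; under eq_bigr do rewrite subr0. Qed.

(** Both terms of [dist11_step] carry a factor [L * R0]: the first through the size of [g], the
    second because [e] is Lipschitz and vanishes at 0. Having two of them turns 8 into the 16 of
    [R0_small]. *)
Lemma step_contraction N g g' : ball g -> ball g' ->
  dist11 (step N g) (step N g') <= 2^-1 * dist11 g g'.
Proof.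
move=> g_R0 g'_R0; apply: le_trans (dist11_step _ _ _ _) _.
have -> : dist11 (hh N) (hh N) = 0.
  by apply: big1 => i _; rewrite subrr (alg_norm0 (norm11P R)).
rewrite mulr0 add0r.
apply: (@le_trans _ _ (8 * kappa *
  \sum_(j < m) (L * dist11 g g' * R0 + L * R0 * dist11 g g'))).
  rewrite ler_wpM2l ?mulr_ge0//; apply: ler_sum => j _.
  rewrite big_split /=; apply: lerD.
    apply: (@le_trans _ _ (\sum_k L * dist11 g g' * norm11 (g k))).
      by apply: ler_sum => k _; rewrite ler_wpM2r// e_lipschitz//; apply: ball_rho.
    rewrite -mulr_sumr; apply: ler_wpM2l; last exact: sum_norm11_ball.
    by apply: mulr_ge0 => //; apply: dist11_ge0.
  rewrite [X in _ <= _ * X]/dist11 mulr_sumr; apply: ler_sum => k _.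
  rewrite ler_wpM2r// -[e _ _ _ _]subr0 -(e_0 N j k).
  apply: le_trans (e_lipschitz _ _ _ (ball_rho g'_R0) _) _; last first.
    by rewrite ler_wpM2l.
  by move=> i; rewrite (alg_norm0 (norm11P R)); apply: le_trans R0_rho.
rewrite sumr_const card_ord -[_ *+ m]mulr_natr.
have -> : 8 * kappa * ((L * dist11 g g' * R0 + L * R0 * dist11 g g') * m%:R) =
  16 * kappa * m%:R * L * R0 * dist11 g g' by ring.
by rewrite ler_wpM2r ?dist11_ge0.
Qed.

(** The step maps 0 to the data plus its conjugate, of size at most [R0 / 2], and the contraction
    adds at most another [R0 / 2]. Hence the quarter in [hh_small]. *)
Lemma iterate_ball N : ball (iterate N).
Proof.
have ball0 : ball (fun=> 0).
  by rewrite sum_norm11E big1// => i _; rewrite (alg_norm0 (norm11P R)).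
elim: N => [//|N IH]; rewrite /iterate iteriS -/(iterate N).
apply: le_trans (dist11_trans _ (step N (fun=> 0)) _) _.
have := step_contraction N IH ball0.
suff : dist11 (step N (fun=> 0)) (fun=> 0) <= R0 / 2.
  by move: IH; lra.
rewrite sum_norm11E.
have -> : R0 / 2 = 2 * (R0 / 4) by field.
apply: (@le_trans _ _ (2 * dist11 (hh N) (fun=> 0))); last by rewrite ler_wpM2l.
rewrite sum_norm11E mulr_sumr; apply: ler_sum => i _.
have -> : step N (fun=> 0) i = hh N i + sigma (hh N i).
  rewrite /step /half_step big1 ?dbar_inv0 ?addr0// => j _.
  by rewrite /field_term big1 ?mulr0// => k _; rewrite deriv0 mulr0.
by apply: le_trans (alg_normD (norm11P R) _ _) _; rewrite norm11_sigma; lra.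
Qed.

(** Inserting [step N.+1 (iterate N)] separates the contraction from the change of order, so each
    distance is at most half the previous one plus an error. After summation, half of the sum is
    absorbed on the left. *)
Lemma iterate_summable A B : (forall M, \sum_(N < M) a N <= A) ->
  (forall M, \sum_(N < M) dist11 (hh N.+1) (hh N) <= B) ->
  exists S, forall M, \sum_(N < M) dist11 (iterate N.+1) (iterate N) <= S.
Proof.
move=> aA hB; pose d N := dist11 (iterate N.+1) (iterate N).
pose E := 2 * B + 8 * kappa * m%:R * R0 * A.
have d_step N : d N.+1 <= 2^-1 * d N +
    (2 * dist11 (hh N.+1) (hh N) + 8 * kappa * m%:R * R0 * a N).
  rewrite /d {1}/iterate iteriS -/(iterate N.+1).
  apply: le_trans (dist11_trans _ (step N.+1 (iterate N)) _) _.
  apply: lerD; first by apply: step_contraction; apply: iterate_ball.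
  rewrite [X in dist11 _ X](_ : _ = step N (iterate N)); last by rewrite /iterate iteriS.
  apply: le_trans (dist11_step _ _ _ _) _; rewrite lerD2l.
  apply: (@le_trans _ _ (8 * kappa * \sum_(j < m) (a N * R0))); last first.
    rewrite sumr_const card_ord -[_ *+ m]mulr_natr le_eqVlt; apply/orP; left.
    by apply/eqP; ring.
  rewrite ler_wpM2l ?mulr_ge0//; apply: ler_sum => j _.
  have a_ge0 : 0 <= a N.
    apply: le_trans (e_step N j j (ball_rho (iterate_ball N))).
    exact: norm11_ge0.
  apply: (@le_trans _ _ (\sum_k a N * norm11 (iterate N k))); last first.
    rewrite -mulr_sumr; apply: ler_wpM2l => //.
    by apply: sum_norm11_ball; apply: iterate_ball.
  apply: ler_sum => k _.
  rewrite subrr (alg_norm0 (norm11P R)) mulr0 addr0 ler_wpM2r//.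
  by apply: e_step; apply: ball_rho; apply: iterate_ball.
have sum_d M : \sum_(N < M.+1) d N <= d 0%N + 2^-1 * \sum_(N < M) d N + E.
  rewrite big_ord_recl -addrA lerD2l.
  apply: (@le_trans _ _ (\sum_(N < M) (2^-1 * d N +
    (2 * dist11 (hh N.+1) (hh N) + 8 * kappa * m%:R * R0 * a N)))).
    by apply: ler_sum => N _; apply: d_step.
  rewrite !big_split /= -!mulr_sumr lerD2l /E; apply: lerD.
    by rewrite ler_wpM2l ?hB.
  by rewrite ler_wpM2l ?aA ?mulr_ge0.
exists (2 * (d 0%N + E)) => M.
have := sum_d M; rewrite big_ord_recr /= -/(d _).
have : 0 <= d M by apply: dist11_ge0.
rewrite /d; lra.
Qed.

End Iteration.

(** * Limits of polynomials on a disc *)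

Section PointEstimates.
Variable R : rcfType.
Local Notation P := {poly {poly R[i]}}.
Local Notation normc := (@Normc.normc R).
Implicit Types (p q : P) (s t : R) (z w h : R[i]).

Let normc_ge0 z : 0 <= normc z := alg_norm_ge0 (normc_alg_norm R) z.

Definition norm_disc s p : R := pnorm2 (fun k => s ^+ k) (fun k => s ^+ k) p.

Lemma norm_discP s : 0 <= s -> alg_norm (norm_disc s).
Proof. by move=> s_ge0; apply: pnorm2_alg_norm; apply: weightX. Qed.

Lemma norm_disc_ge0 s p : 0 <= s -> 0 <= norm_disc s p.
Proof. by move=> s_ge0; apply: alg_norm_ge0; apply: norm_discP. Qed.

Lemma le_pnorm2 (w1 w2 w1' w2' : nat -> R) p :
  weight w1 -> weight w2 -> (forall k, w1 k <= w1' k) -> (forall k, w2 k <= w2' k) ->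
  pnorm2 w1 w2 p <= pnorm2 w1' w2' p.
Proof.
move=> [w1_ge0 _ _] w2_wt w1_le w2_le; apply: ler_sum => i _; apply: ler_pM => //.
  exact: alg_norm_ge0 (pnorm_normc_alg_norm w2_wt) _.
by apply: le_pnorm => //; exact: normc_alg_norm.
Qed.

Lemma norm_disc_le s s' p : 0 <= s -> s <= s' -> norm_disc s p <= norm_disc s' p.
Proof.
move=> s_ge0 s_s'; have s'_ge0 := le_trans s_ge0 s_s'.
by apply: le_pnorm2; try exact: weightX; move=> k; rewrite lerXn2r ?nnegrE.
Qed.

Lemma norm_disc1_le p : norm_disc 1 p <= norm11 p.
Proof.
by apply: le_pnorm2; try exact: weightX; move=> k; rewrite expr1n ler1n.
Qed.

(** The real differential at [z] of the function that [p] defines, in Wirtinger form; [ev_rem] is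
    the second-order Taylor remainder. *)
Definition ev_diff p z h := ev z (dz p) * h + ev z p^`() * h^*.

Definition ev_rem p z w := ev w p - ev z p - ev_diff p z (w - z).

Lemma ev_diffE p p1 p2 a b z h : dz p = p1 -> p^`() = p2 ->
  ev z p1 = a -> ev z p2 = b -> ev_diff p z h = a * h + b * h^*.
Proof. by rewrite /ev_diff => <- <- <- <-. Qed.

Section Bounds.
Variables (s t : R) (z w : R[i]).
Hypotheses (s_ge0 : 0 <= s) (t_ge0 : 0 <= t).
Hypotheses (z_s : normc z <= s) (w_s : normc w <= s).
Local Notation h := (w - z).

(** Cauchy estimates without contour integrals, [t] being the margin between the radii. Such bounds
    add up, and a factor z or conj z multiplies [M] by [s + t]; building up the polynomial thus
    yields [norm_disc (s + t) p]. *)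
Let dev_bound p (M : R) := [/\ normc (ev z p) <= M, normc (ev w p) <= M,
  t * normc (ev_diff p z h) <= M * normc h &
  t ^+ 2 * normc (ev_rem p z w) <= M * normc h ^+ 2].

Let dev_bound0 : dev_bound 0 0.
Proof.
rewrite /dev_bound /ev_rem /ev_diff dz0 deriv0 !ev0.
by rewrite !(mul0r, addr0, subr0) Normc.normc0 !mulr0.
Qed.

Let dev_boundD p M q M' : dev_bound p M -> dev_bound q M' ->
  dev_bound (p + q) (M + M').
Proof.
have diffD : ev_diff (p + q) z h = ev_diff p z h + ev_diff q z h.
  by rewrite /ev_diff dzD derivD !rmorphD /=; ring.
have remD : ev_rem (p + q) z w = ev_rem p z w + ev_rem q z w.
  by rewrite /ev_rem diffD !rmorphD /=; ring.
move=> [p1 p2 p3 p4] [q1 q2 q3 q4]; split; rewrite ?remD ?diffD ?rmorphD /= ?mulrDl.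
- exact: le_trans (le_normcD _ _) (lerD p1 q1).
- exact: le_trans (le_normcD _ _) (lerD p2 q2).
- apply: le_trans (lerD p3 q3); rewrite -mulrDr ler_wpM2l//; exact: le_normcD.
- apply: le_trans (lerD p4 q4); rewrite -mulrDr ler_wpM2l ?exprn_ge0//; exact: le_normcD.
Qed.

(* The hypotheses on [q] mean that it is affine, as the two variables are. *)
Let dev_boundM p M q : 0 <= M -> dev_bound p M ->
  normc (ev z q) <= s -> normc (ev w q) <= s -> normc (ev_diff q z h) <= normc h ->
  ev_rem q z w = 0 -> dev_bound (p * q) ((s + t) * M).
Proof.
move=> M_ge0 [p1 p2 p3 p4] q1 q2 q3 q4.
have diffM : ev_diff (p * q) z h = ev_diff p z h * ev z q + ev z p * ev_diff q z h.
  by rewrite /ev_diff dzM derivM !(rmorphD, rmorphM) /=; ring.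
have evq : ev w q = ev z q + ev_diff q z h.
  by apply/eqP; rewrite addrC -subr_eq -subr_eq0 -q4 /ev_rem.
have remM : ev_rem (p * q) z w = ev_diff p z h * ev_diff q z h + ev_rem p z w * ev w q.
  rewrite /ev_rem diffM !rmorphM /= evq; ring.
have hM x y X Y : normc x <= X -> normc y <= Y -> normc (x * y) <= X * Y.
  by move=> xX yY; rewrite Normc.normcM ler_pM.
have bnd x y : normc x <= M -> normc y <= s -> normc (x * y) <= (s + t) * M.
  move=> xM ys; apply: le_trans (hM _ _ _ _ xM ys) _.
  by rewrite mulrC ler_wpM2r// lerDl.
split; rewrite ?rmorphM /= ?remM ?diffM; try exact: bnd.
- apply: (@le_trans _ _ (t * normc (ev_diff p z h) * normc (ev z q) +
     t * (normc (ev z p) * normc (ev_diff q z h)))).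
    rewrite -mulrA -mulrDr ler_wpM2l// -!Normc.normcM; exact: le_normcD.
  have -> : (s + t) * M * normc h = M * normc h * s + t * (M * normc h) by ring.
  by apply: lerD; [|rewrite ler_wpM2l//]; apply: ler_pM; rewrite ?mulr_ge0.
- apply: (@le_trans _ _ (t * (t * normc (ev_diff p z h) * normc (ev_diff q z h)) +
     t ^+ 2 * normc (ev_rem p z w) * normc (ev w q))).
    rewrite -[t * _ * _]mulrA [t * (t * _)]mulrA -expr2 -[_ * _ * normc (ev w q)]mulrA.
    rewrite -mulrDr ler_wpM2l ?exprn_ge0// -!Normc.normcM; exact: le_normcD.
  have -> : (s + t) * M * normc h ^+ 2 =
    t * (M * normc h * normc h) + M * normc h ^+ 2 * s by ring.
  by apply: lerD; [rewrite ler_wpM2l//|]; apply: ler_pM; rewrite ?mulr_ge0 ?exprn_ge0.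
Qed.

Let dev_boundC c : dev_bound c%:P%:P (normc c).
Proof.
have diffC : ev_diff c%:P%:P z h = 0.
  by rewrite /ev_diff dzC !derivC ev0 !mul0r addr0.
rewrite /dev_bound /ev_rem diffC !ev_polyC subrr subr0 Normc.normc0 !mulr0.
by rewrite !mulr_ge0 ?exprn_ge0.
Qed.

Let dev_boundX p M : 0 <= M -> dev_bound p M -> dev_bound (p * 'X) ((s + t) * M).
Proof.
move=> M_ge0 pM.
have diffX : ev_diff 'X z h = h^*.
  by rewrite (ev_diffE _ (dzX _) (derivX _) (ev0 z) (ev1 z)) mul0r add0r mul1r.
apply: dev_boundM => //; rewrite ?ev_X ?diffX ?normcJ_real//.
by rewrite /ev_rem diffX !ev_X rmorphB /= subrr.
Qed.

Let dev_boundY p M : 0 <= M -> dev_bound p M -> dev_bound (p * 'X%:P) ((s + t) * M).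
Proof.
move=> M_ge0 pM.
have diffY : ev_diff 'X%:P z h = h.
  have dzY : dz 'X%:P = 1 :> P by rewrite dzC derivX.
  by rewrite (ev_diffE _ dzY (derivC _) (ev1 z) (ev0 z)) mul0r addr0 mul1r.
apply: dev_boundM => //; rewrite ?ev_Y ?diffY//.
by rewrite /ev_rem diffY !ev_Y subrr.
Qed.

Lemma ev_bounds p : [/\ normc (ev z p) <= norm_disc (s + t) p,
   normc (ev w p) <= norm_disc (s + t) p &
   t ^+ 2 * normc (ev_rem p z w) <= norm_disc (s + t) p * normc h ^+ 2].
Proof.
have st_ge0 : 0 <= s + t by rewrite addr_ge0.
suff : dev_bound p (norm_disc (s + t) p) by case.
have inner (q : {poly R[i]}) : dev_bound q%:P (pnorm normc (fun k => (s + t) ^+ k) q).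
  rewrite -{1}(coefK q) poly_def rmorph_sum /= /pnorm.
  elim/big_ind2: _ => [//|x1 x2 y1 y2|j _]; first exact: dev_boundD.
  rewrite -mul_polyC polyCM polyC_exp.
  elim: (nat_of_ord j) (q`_j) => [|k IH] c; first by rewrite !expr0 mulr1 mul1r.
  rewrite exprSr mulrA exprS -[_ * _ * _ in X in dev_bound _ X]mulrA; apply: dev_boundY => //.
  by rewrite mulr_ge0 ?exprn_ge0.
rewrite -{1}(coefK p) poly_def /norm_disc /pnorm2 /pnorm.
elim/big_ind2: _ => [//|x1 x2 y1 y2|j _]; first exact: dev_boundD.
rewrite -mul_polyC.
elim: (nat_of_ord j) (p`_j) => [|k IH] c; first by rewrite !expr0 mulr1 mul1r.
rewrite exprSr mulrA exprS -[_ * _ * _ in X in dev_bound _ X]mulrA; apply: dev_boundX => //.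
rewrite mulr_ge0 ?exprn_ge0//.
exact: alg_norm_ge0 (pnorm_normc_alg_norm (weightX st_ge0)) _.
Qed.

End Bounds.

(** The power [k + 1] is convex, hence above its tangent at [s']. This pays for the factor [k + 1]
    of a derivative by a larger radius. *)
Lemma bernoulli_expr s' s k : 0 <= s' -> s' <= s ->
  (k.+1%:R * s' ^+ k) * (s - s') <= s ^+ k.+1.
Proof.
move=> s'_ge0 s's; elim: k => [|k IH]; first by rewrite expr0 expr1; lra.
have -> : k.+2%:R * s' ^+ k.+1 * (s - s') =
    s' * (k.+1%:R * s' ^+ k * (s - s')) + s' ^+ k.+1 * (s - s').
  by rewrite -[k.+2]addn1 natrD exprS; ring.
apply: (@le_trans _ _ (s' * s ^+ k.+1 + s ^+ k.+1 * (s - s'))).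
  apply: lerD; first by rewrite ler_wpM2l.
  by rewrite ler_wpM2r ?subr_ge0// lerXn2r// nnegrE// (le_trans s'_ge0).
by rewrite [s ^+ k.+2]exprS; lra.
Qed.

Lemma norm_disc_deriv s' s p : 0 <= s' -> s' < s ->
  norm_disc s' p^`() <= (s - s')^-1 * norm_disc s p.
Proof.
move=> s'_ge0 s's; have s_ge0 : 0 <= s by rewrite (le_trans s'_ge0)// ltW.
have nuP := pnorm_normc_alg_norm (weightX s'_ge0).
have nusP := pnorm_normc_alg_norm (weightX s_ge0).
rewrite /norm_disc /pnorm2 (@pnormE _ _ _ _ (size p) _ (alg_norm0 nuP)); last first.
  by rewrite (leq_trans (size_poly _ _)) ?leq_pred.
rewrite (@pnormE _ _ _ _ (size p).+1 p (alg_norm0 nusP))// ler_pdivlMl ?subr_gt0//.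
rewrite big_ord_recl /= ler_wpDl ?mulr_ge0 ?(alg_norm_ge0 nusP)//.
rewrite mulr_sumr; apply: ler_sum => i _; rewrite coef_deriv /bump /= ?add1n.
apply: (@le_trans _ _ ((i.+1%:R * s' ^+ i) * (s - s') *
  pnorm normc (fun k => s' ^+ k) p`_i.+1)).
  have -> : forall a b c d : R, a * b * c * d = c * (b * (a * d)) by move=> *; ring.
  rewrite ler_wpM2l ?subr_ge0 ?(ltW s's)// ler_wpM2l ?exprn_ge0//.
  exact: alg_norm_muln.
apply: ler_pM; rewrite ?(alg_norm_ge0 nuP) ?bernoulli_expr ?(ltW s's)//.
  by rewrite !mulr_ge0 ?exprn_ge0 ?subr_ge0 ?(ltW s's).
apply: le_pnorm => [|k]; first exact: normc_alg_norm.
by rewrite lerXn2r ?nnegrE// ltW.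
Qed.

Lemma norm_disc_dz s' s p : 0 <= s' -> s' < s ->
  norm_disc s' (dz p) <= (s - s')^-1 * norm_disc s p.
Proof.
move=> s'_ge0 s's; rewrite /dz /norm_disc pnorm2_swap -(pnorm2_swap _ p).
exact: norm_disc_deriv.
Qed.

End PointEstimates.

(** * Differentiability from quadratic remainders *)

Section Columns.
Variable R : realType.

Lemma le_col_norm k (w : 'cV[R]_k) i : `|w i 0| <= `|w|.
Proof.
rewrite -[`|w|]/(mx_norm w) mx_normrE; apply/bigmax_geP; right => /=.
by exists (i, 0).
Qed.

Lemma col_norm_le k (w : 'cV[R]_k) c : 0 <= c ->
  (forall i, `|w i 0| <= c) -> `|w| <= c.
Proof.
move=> c_ge0 w_c; rewrite -[`|w|]/(mx_norm w) mx_normrE; apply/bigmax_leP; split=> //.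
by move=> [i j] _ /=; rewrite [j]ord1.
Qed.

(** A quadratic bound is assumed instead of a little o because, when uniform along a sequence, it
    survives the passage to the limit. *)
Lemma quadratic_remainder_diff (V W : normedModType R) (f : V -> W)
    (df : {linear V -> W}) v K r : continuous df -> 0 < r ->
  (forall h, `|h| < r -> `|f (h + v) - f v - df h| <= K * `|h| ^+ 2) ->
  differentiable f v /\ 'd f v = df :> (V -> W).
Proof.
move=> df_cont r_gt0 f_rem.
have df_rem : f \o shift v = cst (f v) + df +o_ 0 id.
  apply/eqaddoP => e e_gt0; near=> h.
  apply: (@le_trans _ _ (`|K| * `|h| ^+ 2)).
    rewrite !fctE opprD addrA.
    apply: le_trans (f_rem h _) _; last by rewrite ler_wpM2r ?exprn_ge0// ler_norm.
    by near: h; apply: nbhs0_lt.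
  rewrite expr2 mulrA ler_wpM2r//.
  have h_small : `|h| <= e / (`|K| + 1).
    by near: h; apply: nbhs0_le; rewrite divr_gt0// ltr_wpDl.
  apply: le_trans (ler_wpM2l (normr_ge0 K) h_small) _.
  rewrite mulrCA ler_piMr ?(ltW e_gt0)// ler_pdivrMr ?ltr_wpDl// mul1r lerDl.
  exact: ler01.
have diff_f : 'd f v = df :> (V -> W) by apply: diff_unique.
split=> //; by apply/diff_locallyP; rewrite diff_f.
Unshelve. all: by end_near. Qed.

Lemma col_remainder_diff k (f : 'cV[R]_(1 + 1) -> 'cV[R]_k) v (A B : 'cV[R]_k) K r :
  0 < r -> (forall h : 'cV[R]_(1 + 1), `|h| < r -> forall i,
    `|f (h + v) i 0 - f v i 0 - (h 0 0 * A i 0 + h 1 0 * B i 0)| <= K * `|h| ^+ 2) ->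
  differentiable f v /\ 'd f v = (fun h => h 0 0 *: A + h 1 0 *: B) :> (_ -> _).
Proof.
move=> r_gt0 f_rem.
pose g (h : 'cV[R]_(1 + 1)) : 'cV[R]_k := h 0 0 *: A + h 1 0 *: B.
have g_lin : linear g.
  by move=> a h h'; rewrite /g !mxE !scalerDl -!scalerA addrACA -scalerDr.
pose g_linM := GRing.isLinear.Build R 'cV[R]_(1 + 1) 'cV[R]_k _ g g_lin.
pose df : {linear 'cV[R]_(1 + 1) -> 'cV[R]_k} := HB.pack g g_linM.
have g_cont : continuous g.
  move=> h; have := cvgD (cvgZr_tmp (a:=A) (@coord_continuous R _ _ 0 0 h))
    (cvgZr_tmp (a:=B) (@coord_continuous R _ _ 1 0 h)).
  exact.
have df_cont : continuous df by exact: g_cont.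
apply: (@quadratic_remainder_diff _ _ f df v `|K| r) => // h h_r.
apply: col_norm_le => [|i]; first by rewrite mulr_ge0 ?exprn_ge0.
rewrite !mxE; apply: le_trans (f_rem h h_r i) _.
by rewrite ler_wpM2r ?exprn_ge0// ler_norm.
Qed.

End Columns.

Section Limits.
Variable R : realType.
Local Notation P := {poly {poly R[i]}}.
Local Notation normc := (@Normc.normc R).
Implicit Types (p q : nat -> P) (s : R).

Lemma normc_ge_Re_real (z : R[i]) : `|complex.Re z| <= normc z.
Proof.
case: z => a b /=; rewrite -sqrtr_sqr ler_wsqrtr//.
by rewrite lerDl sqr_ge0.
Qed.

Lemma ReB (a b : R[i]) : complex.Re (a - b) = complex.Re a - complex.Re b.
Proof. by case: a b => [a a'] [b b']. Qed.

Lemma ReD (a b : R[i]) : complex.Re (a + b) = complex.Re a + complex.Re b.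
Proof. by case: a b => [a a'] [b b']. Qed.

Lemma ev_le_norm_disc s z (p : P) : normc z <= s -> normc (ev z p) <= norm_disc s p.
Proof.
move=> z_s; have s_ge0 : 0 <= s.
  by apply: le_trans z_s; apply: alg_norm_ge0 (normc_alg_norm R) z.
by have [+ _ _] := ev_bounds s_ge0 (lexx 0) z_s z_s p; rewrite addr0.
Qed.

Lemma bounded_variation_cvg (u : nat -> R) B :
  (forall M, \sum_(N < M) `|u N.+1 - u N| <= B) -> cvgn u.
Proof.
move=> u_B; have -> : u = (fun n => u 0%N + series (telescope u) n).
  by apply/funext => n; exact: eq_sum_telescope.
apply: is_cvgD; first exact: is_cvg_cst.
apply: normed_cvg; apply: nondecreasing_is_cvgn.
  by apply: nondecreasing_series => n *; apply: normr_ge0.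
exists B => _ [n _ <-]; have := u_B n.
by rewrite -(big_mkord xpredT (fun N => `|u N.+1 - u N|)).
Qed.

(** Stands for convergence in the completed algebra. It needs no limit object there, and additive
    maps bounded between two such norms preserve it. *)
Definition sum_increments s p := exists B, forall M,
  \sum_(N < M) norm_disc s (p N.+1 - p N) <= B.

Lemma sum_increments_bounded s p : 0 <= s -> sum_increments s p ->
  exists K, forall N, norm_disc s (p N) <= K.
Proof.
move=> s_ge0 [B p_B]; have nuP := norm_discP s_ge0.
exists (norm_disc s (p 0%N) + B) => N; apply: le_trans (lerD (lexx _) (p_B N)).
elim: N => [|N IH]; first by rewrite big_ord0 addr0.
rewrite big_ord_recr addrA /=; apply: le_trans (lerD IH (lexx _)).
by rewrite -{1}(subrK (p N) (p N.+1)) addrC; apply: alg_normD nuP _ _.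
Qed.

Lemma sum_increments_cvg s p z : sum_increments s p -> normc z <= s ->
  cvgn (fun N => complex.Re (ev z (p N))).
Proof.
move=> [B p_B] z_s; apply: (@bounded_variation_cvg _ B) => M.
apply: le_trans (p_B M); apply: ler_sum => N _.
have -> : complex.Re (ev z (p N.+1)) - complex.Re (ev z (p N)) =
    complex.Re (ev z (p N.+1 - p N)).
  by rewrite evB ReB.
apply: le_trans (normc_ge_Re_real _) _; exact: ev_le_norm_disc.
Qed.

Lemma sum_increments_linear s s' p c (D : P -> P) :
  (forall a b, D (a - b) = D a - D b) ->
  (forall a, norm_disc s' (D a) <= c * norm_disc s a) -> 0 <= c ->
  sum_increments s p -> sum_increments s' (D \o p).
Proof.
move=> DB D_c c_ge0 [B p_B]; exists (c * B) => M.
apply: le_trans (ler_wpM2l c_ge0 (p_B M)); rewrite mulr_sumr.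
by apply: ler_sum => N _ /=; rewrite -DB.
Qed.

(** The y-derivative, by the chain rule for z = x + iy and its conjugate x - iy. *)
Definition dy (p : P) : P := 'i%:P%:P * (dz p - p^`()).

Lemma sum_increments_dx s s' p : 0 <= s' -> s' < s ->
  sum_increments s p -> sum_increments s' (@dx _ \o p).
Proof.
move=> s'_ge0 s's; have inv_ge0 : 0 <= (s - s')^-1 by rewrite invr_ge0 subr_ge0 ltW.
apply: (@sum_increments_linear _ _ _ (2 * (s - s')^-1)) => [|a|].
- exact: dxB.
- rewrite /dx; apply: le_trans (alg_normD (norm_discP s'_ge0) _ _) _.
  by have := norm_disc_dz a s'_ge0 s's; have := norm_disc_deriv a s'_ge0 s's; lra.
- by rewrite mulr_ge0.
Qed.

Lemma sum_increments_dy s s' p : 0 <= s' -> s' < s ->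
  sum_increments s p -> sum_increments s' (dy \o p).
Proof.
move=> s'_ge0 s's; have inv_ge0 : 0 <= (s - s')^-1 by rewrite invr_ge0 subr_ge0 ltW.
apply: (@sum_increments_linear _ _ _ (2 * (s - s')^-1)) => [a b|a|].
- by rewrite /dy dzB derivB; ring.
- rewrite /dy; have nuP := norm_discP s'_ge0.
  apply: le_trans (alg_normM nuP _ _) _.
  have -> : norm_disc s' 'i%:P%:P = 1.
    have wX := weightX s'_ge0.
    rewrite /norm_disc /pnorm2 pnormC//; last exact: pnorm_normc_alg_norm.
    rewrite pnormC//; last exact: normc_alg_norm.
    by rewrite /= expr0n add0r expr1n sqrtr1.
  rewrite mul1r; apply: le_trans (alg_normB nuP _ _) _.
  by have := norm_disc_dz a s'_ge0 s's; have := norm_disc_deriv a s'_ge0 s's; lra.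
- by rewrite mulr_ge0.
Qed.

End Limits.

Section LimitFunctions.
Variable R : realType.
Local Notation P := {poly {poly R[i]}}.
Local Notation normc := (@Normc.normc R).

Definition cz (v : 'cV[R]_(1 + 1)) : R[i] := v 0 0 +i* v 1 0.

Lemma czD v w : cz (v + w) = cz v + cz w.
Proof. by rewrite /cz !mxE. Qed.

Lemma normc_cz v : normc (cz v) = enorm v.
Proof.
rewrite /enorm /= !big_ord_recl big_ord0 addr0.
by congr (Num.sqrt (_ + v _ 0 ^+ 2)); apply: val_inj.
Qed.

Lemma normc_cz_le v : normc (cz v) <= 2 * `|v|.
Proof.
have -> : cz v = (v 0 0)%:C + 'i * (v 1 0)%:C by rewrite [LHS]complexE.
apply: le_trans (le_normcD _ _) _; rewrite Normc.normcM.
rewrite /= !expr0n /= !addr0 add0r expr1n sqrtr1 mul1r !sqrtr_sqr.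
by have := le_col_norm v 0; have := le_col_norm v 1; lra.
Qed.

Lemma ev_diff_dxdy (p : P) z (h : 'cV[R]_(1 + 1)) :
  ev_diff p z (cz h) = (h 0 0)%:C * ev z (dx p) + (h 1 0)%:C * ev z (dy p).
Proof.
rewrite /ev_diff /dx /dy evM evB evD ev_polyC.
move: (ev z (dz p)) (ev z p^`()) => [a a'] [b b'].
by apply/eqP; rewrite eq_complex /=; apply/andP; split; apply/eqP; ring.
Qed.

Lemma ReCM (a : R) (z : R[i]) : complex.Re (a%:C * z) = a * complex.Re z.
Proof. by case: z => x y /=; rewrite mul0r subr0. Qed.

(** The iterates are real-valued by [sigma_iterate], so the real part loses nothing. As [limn] is
    total, the value is meaningful only when the sequence converges. *)
Definition lim_re (p : nat -> P) v : R := limn (fun N => complex.Re (ev (cz v) (p N))).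

Definition lim_col k (p : nat -> 'I_k -> P) v : 'cV[R]_k :=
  \col_i lim_re (fun N => p N i) v.

(** The remainder bound of [ev_bounds] is uniform in [N] and passes to the limit. The 4 is the
    square of the constant in [normc_cz_le], which compares the modulus with the sup norm. *)
Lemma lim_re_remainder (p : nat -> P) s t K v h :
  0 < t -> sum_increments (s + t) p -> (forall N, norm_disc (s + t) (p N) <= K) ->
  enorm v <= s -> enorm (h + v) <= s ->
  `|lim_re p (h + v) - lim_re p v -
    (h 0 0 * lim_re (@dx _ \o p) v + h 1 0 * lim_re (@dy _ \o p) v)| <=
  4 / t ^+ 2 * K * `|h| ^+ 2.
Proof.
move=> t_gt0 p_inc p_K; rewrite -!normc_cz => v_s hv_s.
have s_ge0 : 0 <= s by apply: le_trans v_s; apply: alg_norm_ge0 (normc_alg_norm R) _.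
have s_st : s < s + t by rewrite ltrDl.
have v_st := le_trans v_s (ltW s_st); have hv_st := le_trans hv_s (ltW s_st).
have K_ge0 : 0 <= K.
  by apply: le_trans (p_K 0%N); apply: norm_disc_ge0; apply: le_trans s_ge0 (ltW _).
set l := (X in `|X| <= _).
pose r N := complex.Re (ev_rem (p N) (cz v) (cz (h + v))).
have r_l : r @ \oo --> l.
  have -> : r = (fun N => complex.Re (ev (cz (h + v)) (p N)) -
     complex.Re (ev (cz v) (p N)) - (h 0 0 * complex.Re (ev (cz v) (dx (p N))) +
     h 1 0 * complex.Re (ev (cz v) (dy (p N))))).
    apply/funext => N; rewrite /r /ev_rem czD addrK ev_diff_dxdy -czD.
    by rewrite !ReB ReD !ReCM.
  have dx_inc := sum_increments_dx s_ge0 s_st p_inc.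
  have dy_inc := sum_increments_dy s_ge0 s_st p_inc.
  apply: cvgB; first apply: cvgB.
  - exact: sum_increments_cvg p_inc hv_st.
  - exact: sum_increments_cvg p_inc v_st.
  apply: cvgD; (apply: cvgM; first exact: cvg_cst).
  - exact: sum_increments_cvg dx_inc v_s.
  - exact: sum_increments_cvg dy_inc v_s.
have r_norm : (fun N => `|r N|) @ \oo --> `|l| by apply: cvg_norm r_l.
rewrite -(cvg_lim _ r_norm)//; apply: limr_le; first exact: cvgP r_norm.
apply: nearW => N.
apply: le_trans (normc_ge_Re_real _) _.
have [_ _ rem_le] := ev_bounds s_ge0 (ltW t_gt0) v_s hv_s (p N).
have t2_gt0 : 0 < t ^+ 2 by rewrite exprn_gt0.
rewrite -(ler_pM2l t2_gt0); apply: le_trans rem_le _.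
have -> : t ^+ 2 * (4 / t ^+ 2 * K * `|h| ^+ 2) = K * (2 * `|h|) ^+ 2.
  by field; rewrite gt_eqF.
apply: ler_pM; rewrite ?exprn_ge0//.
- exact: alg_norm_ge0 (norm_discP (le_trans s_ge0 (ltW s_st))) _.
- exact: alg_norm_ge0 (normc_alg_norm R) _.
rewrite czD addrK lerXn2r ?nnegrE ?mulr_ge0//; last exact: normc_cz_le.
exact: alg_norm_ge0 (normc_alg_norm R) _.
Qed.

Definition col_increments k s (p : nat -> 'I_k -> P) :=
  forall i, sum_increments s (fun N => p N i).

Lemma lim_col_diff k s (p : nat -> 'I_k -> P) v :
  col_increments s p -> enorm v < s ->
  differentiable (lim_col p) v /\
  'd (lim_col p) v = (fun h => h 0 0 *: lim_col (fun N i => dx (p N i)) v +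
     h 1 0 *: lim_col (fun N i => dy (p N i)) v) :> (_ -> _).
Proof.
move=> p_inc v_s; have v_ge0 : 0 <= enorm v by apply: sqrtr_ge0.
(* Half of the gap between [v] and the radius [s] is spent on moving the point, the other half is
   the margin of the Cauchy estimate. The radius [t / 2] for [h] below allows for the factor 2 of
   [normc_cz_le]. *)
pose t := (s - enorm v) / 2; have t_gt0 : 0 < t by rewrite divr_gt0 ?subr_gt0.
have sE : s = (s - t) + t by rewrite subrK.
have v_st : enorm v <= s - t by rewrite /t; lra.
have s_ge0 : 0 <= s by apply: le_trans v_ge0 (ltW _).
have [K K_p] := choice (fun i => sum_increments_bounded s_ge0 (p_inc i)).
have K_ge0 i : 0 <= K i by apply: le_trans (K_p i 0%N); apply: norm_disc_ge0.
apply: (@col_remainder_diff _ _ _ _ _ _ (4 / t ^+ 2 * \sum_i K i) (t / 2)).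
  by rewrite divr_gt0.
move=> h h_small i; rewrite !mxE.
apply: (@lim_re_remainder _ (s - t) t) => //; rewrite -?sE//.
- move=> N; apply: le_trans (K_p i N) _.
  by rewrite (bigD1 i)//= lerDl sumr_ge0.
- rewrite -!normc_cz czD; apply: le_trans (le_normcD _ _) _.
  have tE : t = (s - enorm v) / 2 by [].
  by rewrite (normc_cz v); have := normc_cz_le h; lra.
Qed.

Lemma col_increments_dx k s s' (p : nat -> 'I_k -> P) : 0 <= s' -> s' < s ->
  col_increments s p -> col_increments s' (fun N i => dx (p N i)).
Proof. by move=> s'_ge0 s's p_inc i; apply: sum_increments_dx (p_inc i). Qed.

Lemma col_increments_dy k s s' (p : nat -> 'I_k -> P) : 0 <= s' -> s' < s ->
  col_increments s p -> col_increments s' (fun N i => dy (p N i)).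
Proof. by move=> s'_ge0 s's p_inc i; apply: sum_increments_dy (p_inc i). Qed.

Lemma lim_col_cvg k s (p : nat -> 'I_k -> P) v i : col_increments s p -> enorm v <= s ->
  (fun N => complex.Re (ev (cz v) (p N i))) @ \oo --> lim_col p v i 0.
Proof.
move=> p_inc v_s; rewrite mxE; apply: sum_increments_cvg (p_inc i) _.
by rewrite normc_cz.
Qed.

End LimitFunctions.

(** * The equation of J-holomorphic discs *)

Section Analytic.
Variable R : realType.

Lemma box_index_inj m N : injective (@box_index m N).
Proof.
move=> b b' /ffunP bb'; apply/ffunP => i; apply: val_inj.
by have := bb' i; rewrite !ffunE.
Qed.

Lemma summable_box_le m (F : {ffun 'I_m -> nat} -> R) :
  summable [set: {ffun 'I_m -> nat}] (fun alpha => (F alpha)%:E) ->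
  exists M, forall N, \sum_(beta : {ffun 'I_m -> 'I_N}) `|F (box_index beta)| <= M.
Proof.
rewrite /summable => sum_F.
have sum_ge0 : (0 <= \esum_(a in [set: {ffun 'I_m -> nat}]) `|(F a)%:E|)%E.
  exact: esum_ge0.
exists (fine (\esum_(a in [set: {ffun 'I_m -> nat}]) `|(F a)%:E|)%E) => N.
rewrite -lee_fin fineK; last by rewrite ge0_fin_numE.
pose r := [seq box_index beta | beta : {ffun 'I_m -> 'I_N}].
have r_uniq : uniq r by rewrite map_inj_uniq ?enum_uniq//; apply: box_index_inj.
apply: esum_ge; exists [set` r]; first by split=> //; apply: finite_seq.
rewrite -fsbig_seq// big_map big_enum /= -sumEFin.
by apply: lee_sum => beta _; apply: lexx.
Qed.

(** As in Abel's lemma, absolute convergence at the single point with all coordinates [e / 2] bounds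
    the majorant of that radius. *)
Lemma real_analytic_at0 m (f : 'cV[R]_m -> R) : real_analytic_at f 0 ->
  exists (c : {ffun 'I_m -> nat} -> R) (rho M : R),
    [/\ 0 < rho, forall N, box_norm c rho N <= M &
      forall h : 'cV[R]_m, (forall i, `|h i 0| <= rho) ->
        (fun N => box_sum idfun c N (fun i => h i 0)) @ \oo --> f h].
Proof.
move=> [c /nbhs_ballP[e /= e_gt0 f_c]]; exists c, (e / 2).
have e2_gt0 : 0 < e / 2 by rewrite divr_gt0.
have ball_small (h : 'cV[R]_m) : (forall i, `|h i 0| <= e / 2) -> ball (0 : 'cV[R]_m) e h.
  move=> h_small; rewrite -ball_normE /ball_ /= sub0r normrN.
  by apply: le_lt_trans (col_norm_le _ h_small) _; [exact: ltW|lra].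
have const_small i : `|(const_mx (e / 2) : 'cV[R]_m) i 0| <= e / 2.
  by rewrite mxE ger0_norm ?(ltW e2_gt0).
have [sum_c _] := f_c _ (ball_small _ const_small).
have [M c_M] := summable_box_le sum_c; exists M; split=> // [N|h h_small].
  apply: le_trans (c_M N); apply: ler_sum => beta _; rewrite normrM ler_wpM2l//.
  have -> : monomial (box_index beta) (const_mx (e / 2)) =
      (e / 2) ^+ (\sum_i box_index beta i)%N.
    by rewrite -prodrXr; apply: eq_bigr => i _; rewrite mxE.
  by rewrite ger0_norm// exprn_ge0// ltW.
have [_] := f_c _ (ball_small _ h_small); rewrite add0r.
exact.
Qed.

End Analytic.

(** * The projected equation and the jet of the iterates *)

Section Structure.
Variables (R : realType) (m : nat).
Local Notation P := {poly {poly R[i]}}.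
Local Notation normc := (@Normc.normc R).

Definition cmx k l (A B : 'M[R]_(k, l)) : 'M[R[i]]_(k, l) :=
  \matrix_(i, j) (A i j +i* B i j).

Lemma Re_sum (I : finType) (f : I -> R[i]) :
  complex.Re (\sum_i f i) = \sum_i complex.Re (f i).
Proof. exact: (big_morph (@complex.Re R) (@ReD R) (erefl _)). Qed.

Lemma Im_sum (I : finType) (f : I -> R[i]) :
  complex.Im (\sum_i f i) = \sum_i complex.Im (f i).
Proof.
by apply: (big_morph (@complex.Im R) _ (erefl _)) => a b; case: a b => [a a'] [b b'].
Qed.

Lemma cmxM k l p (A B : 'M[R]_(k, l)) (C D : 'M[R]_(l, p)) :
  cmx A B *m cmx C D = cmx (A *m C - B *m D) (A *m D + B *m C).
Proof.
apply/matrixP => i j; rewrite !mxE; apply/eqP; rewrite eq_complex Re_sum Im_sum /=.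
apply/andP; split; apply/eqP.
  by rewrite -sumrB; apply: eq_bigr => s _; rewrite !mxE.
by rewrite -big_split; apply: eq_bigr => s _; rewrite !mxE.
Qed.

Lemma cmx_inj_Re k l (A B C D : 'M[R]_(k, l)) : cmx A B = cmx C D -> A = C.
Proof.
by move=> /matrixP ABCD; apply/matrixP => i j; have := ABCD i j; rewrite !mxE => -[].
Qed.

Lemma polyCCM (a b : R[i]) : a%:P%:P * b%:P%:P = (a * b)%:P%:P :> P.
Proof. by rewrite !polyCM. Qed.

Lemma sum_polyCC (I : finType) (f : I -> R[i]) :
  \sum_i (f i)%:P%:P = (\sum_i f i)%:P%:P :> P.
Proof. by rewrite !rmorph_sum. Qed.

Lemma sigma0 : sigma 0 = 0 :> P.
Proof. by apply/polyP => k; apply/polyP => l; rewrite coef_sigma !coef0 conjc0. Qed.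

Lemma sigma_deriv (p : P) : sigma p^`() = dz (sigma p).
Proof. by rewrite /sigma /dz swapXYK -!deriv_map. Qed.

Lemma sigma_dz (p : P) : sigma (dz p) = (sigma p)^`().
Proof. by rewrite -{1}(sigmaK p) -sigma_deriv sigmaK. Qed.

Lemma sigma_dx (p : P) : sigma (dx p) = dx (sigma p).
Proof. by rewrite /dx sigmaD sigma_dz sigma_deriv addrC. Qed.

Lemma sigma_dy (p : P) : sigma (dy p) = dy (sigma p).
Proof.
rewrite /dy sigmaM sigmaB sigma_dz sigma_deriv.
have -> : sigma 'i%:P%:P = (- 'i)%:P%:P :> P.
  rewrite sigma_polyC; congr (_%:P%:P).
  by apply/eqP; rewrite eq_complex /= oppr0 !eqxx.
by rewrite !polyCN mulNr -mulrN opprB.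
Qed.

Lemma ev_real z (p : P) : sigma p = p -> ev z p = (complex.Re (ev z p))%:C.
Proof.
move=> /(congr1 (ev z)); rewrite ev_sigma; case: (ev z p) => a b /= [] b_opp.
by have -> : b = 0 by lra.
Qed.

Lemma ev_deriv z (p : P) : sigma p = p -> ev z p^`() =
  (2^-1 * complex.Re (ev z (dx p))) +i* (2^-1 * complex.Re (ev z (dy p))).
Proof.
move=> p_real.
have dxE : ev z (dx p) = (complex.Re (ev z (dx p)))%:C.
  by apply: ev_real; rewrite sigma_dx p_real.
have dyE : ev z (dy p) = (complex.Re (ev z (dy p)))%:C.
  by apply: ev_real; rewrite sigma_dy p_real.
move: dxE dyE; rewrite /dx /dy evM evD evB ev_polyC.
move: (ev z (dz p)) (ev z p^`()) => [a a'] [b b'] /= [] h1 [] h2.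
apply/eqP; rewrite eq_complex /=; apply/andP; split; apply/eqP; lra.
Qed.

Variables (J0 : 'M[R]_m) (x : nat -> 'cV[R]_m).
Hypothesis J0_sqr : J0 *m J0 = - 1%:M.

(** The projection [p] of the overview, onto the eigenspace of [J0] for the eigenvalue i. [proj01]
    is its conjugate, and [half_i_proj10] is (i/2) p = (J0 + i) / 4. *)
Definition proj10 : 'M[R[i]]_m := cmx (2^-1 *: 1%:M) (- 2^-1 *: J0).
Definition proj01 : 'M[R[i]]_m := cmx (2^-1 *: 1%:M) (2^-1 *: J0).
Definition half_i_proj10 : 'M[R[i]]_m := cmx (4^-1 *: J0) (4^-1 *: 1%:M).

Definition taylor_coef k : 'cV[R[i]]_m := proj10 *m cmx ((k`!%:R)^-1 *: x k) 0.

Definition cauchy_data N i : P := (\sum_(k < N) taylor_coef k i 0 *: 'X^k)%:P.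

Lemma taylor_coefE k : taylor_coef k =
  cmx (2^-1 *: ((k`!%:R)^-1 *: x k)) (- 2^-1 *: (J0 *m ((k`!%:R)^-1 *: x k))).
Proof. by rewrite /taylor_coef cmxM !mulmx0 subr0 add0r -!scalemxAl mul1mx. Qed.

Lemma proj01_proj10 : proj01 *m proj10 = 0.
Proof.
rewrite cmxM -!scalemxAl -!scalemxAr !mul1mx !mulmx1 J0_sqr.
apply/matrixP => i j; rewrite !mxE; apply/eqP; rewrite eq_complex /=.
by apply/andP; split; apply/eqP; lra.
Qed.

Lemma proj01_half_i : proj01 *m half_i_proj10 = 0.
Proof.
rewrite cmxM -!scalemxAl -!scalemxAr !mul1mx !mulmx1 J0_sqr.
apply/matrixP => i j; rewrite !mxE; apply/eqP; rewrite eq_complex /=.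
by apply/andP; split; apply/eqP; lra.
Qed.

Lemma proj10_half_i : proj10 *m half_i_proj10 = half_i_proj10.
Proof.
rewrite cmxM -!scalemxAl -!scalemxAr !mul1mx !mulmx1 J0_sqr.
apply/matrixP => i j; rewrite !mxE; apply/eqP; rewrite eq_complex /=.
by apply/andP; split; apply/eqP; lra.
Qed.

Variables (e : nat -> 'I_m -> 'I_m -> ('I_m -> P) -> P).
Local Notation g := (iterate half_i_proj10 e cauchy_data).
Local Notation field N j := (field_term e N (g N) j).
Local Notation half N i := (half_step half_i_proj10 e cauchy_data N (g N) i).

Lemma iterateS N i : g N.+1 i = half N i + sigma (half N i).
Proof. by rewrite {1}/iterate iteriS. Qed.

Lemma sigma_iterate N i : sigma (g N i) = g N i.
Proof.
case: N => [|N]; last by rewrite iterateS sigmaD sigmaK addrC.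
exact: sigma0.
Qed.

(** [G] has values in the range of [p], which the conjugate projection kills. After conjugation, [p]
    kills conj G. *)
Lemma proj01_half N l : \sum_i (proj01 l i)%:P%:P * half N i = 0.
Proof.
have hhE i : cauchy_data N i =
    \sum_(k < N) (taylor_coef k i 0)%:P%:P * ('X^k)%:P.
  by rewrite /cauchy_data rmorph_sum; apply: eq_bigr => k _ /=; rewrite -mul_polyC polyCM.
rewrite /half_step; under eq_bigr do rewrite mulrDr -dbar_invCM.
rewrite big_split /= -dbar_inv_sum.
have -> : \sum_i (proj01 l i)%:P%:P * cauchy_data N i = 0.
  under eq_bigr do rewrite hhE mulr_sumr.
  rewrite exchange_big big1 //= => k _.
  under eq_bigr do rewrite mulrA polyCCM.
  rewrite -mulr_suml sum_polyCC.
  have -> : \sum_i proj01 l i * taylor_coef k i 0 = (proj01 *m taylor_coef k) l 0.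
    by rewrite mxE.
  by rewrite /taylor_coef mulmxA proj01_proj10 mul0mx mxE mul0r.
rewrite add0r; under eq_bigr do rewrite mulr_sumr.
rewrite exchange_big big1 ?dbar_inv0//= => j _.
under eq_bigr do rewrite mulrA polyCCM.
rewrite -mulr_suml sum_polyCC.
have -> : \sum_i proj01 l i * half_i_proj10 i j = (proj01 *m half_i_proj10) l j.
  by rewrite mxE.
by rewrite proj01_half_i mxE mul0r.
Qed.

Lemma deriv_half N i : (half N i)^`() = \sum_j (half_i_proj10 i j)%:P%:P * field N j.
Proof. by rewrite /half_step derivD deriv_dbar_inv derivC add0r. Qed.

(** The conjugate half drops out by [proj01_half]. The relation between consecutive iterates is
    exact, so the limit needs convergence only. *)
Lemma proj10_deriv_iterate N l :
  \sum_i (proj10 l i)%:P%:P * (g N.+1 i)^`() =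
  \sum_j (half_i_proj10 l j)%:P%:P * field N j.
Proof.
under eq_bigr do rewrite iterateS derivD mulrDr.
rewrite big_split /=.
have sigma_proj i : sigma (proj01 l i)%:P%:P = (proj10 l i)%:P%:P.
  rewrite sigma_polyC; congr (_%:P%:P).
  by rewrite !mxE /=; apply/eqP; rewrite eq_complex /= mulNr !eqxx.
have -> : \sum_i (proj10 l i)%:P%:P * (sigma (half N i))^`() =
    (sigma (\sum_i (proj01 l i)%:P%:P * half N i))^`().
  rewrite (big_morph _ (@sigmaD R) sigma0).
  rewrite raddf_sum; apply: eq_bigr => i _ /=.
  by rewrite sigmaM sigma_proj derivM derivC mul0r add0r.
rewrite proj01_half sigma0 deriv0 addr0; under eq_bigr do rewrite deriv_half mulr_sumr.
rewrite exchange_big /=; apply: eq_bigr => j _.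
under eq_bigr do rewrite mulrA polyCCM.
rewrite -mulr_suml sum_polyCC; congr (_%:P%:P * _).
by rewrite -[in RHS]proj10_half_i mxE.
Qed.

(** [T] vanishes on the diagonal, which leaves p h and its conjugate; their sum is h, since h is
    real there and p has real part 1/2. *)
Lemma diag_iterate N i : diag (g N.+1 i) =
  \poly_(k < N) ((k`!%:R)^-1 * x k i 0)%:C.
Proof.
rewrite iterateS {1}/diag hornerD -!/(diag _) diag_sigma.
have -> : diag (half N i) = \sum_(k < N) taylor_coef k i 0 *: 'X^k.
  rewrite /half_step /diag hornerD -/(diag (dbar_inv _)) diag_dbar_inv addr0.
  by rewrite hornerC.
rewrite raddf_sum -big_split /= poly_def; apply: eq_bigr => k _.
rewrite map_polyZ map_polyXn -scalerDl; congr (_ *: _).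
rewrite taylor_coefE [cmx _ _ i 0]mxE; set a := (_ *: _ : 'cV[R]_m) i 0.
have aE : a = 2^-1 * ((k`!%:R)^-1 * x k i 0) by rewrite /a !mxE.
apply/eqP; rewrite eq_complex /= addrN eqxx andbT aE; apply/eqP; lra.
Qed.

(** The jet of order [k] is exact, and not only approximate, as soon as the truncation of h contains
    the power [k]. *)
Lemma Re_ev_dx_iterate N k i : (k < N)%N ->
  complex.Re (ev 0 (iter k (@dx _) (g N.+1 i))) = x k i 0.
Proof.
move=> kN; have -> : (0 : R[i]) = 0%:C by [].
rewrite ev_diag.
have -> : diag (iter k (@dx _) (g N.+1 i)) = (diag (g N.+1 i))^`(k).
  by elim: k {kN} => [//|k IH]; rewrite iterS diag_dx IH derivnS.
rewrite diag_iterate horner_coef0 coef_derivn addn0 coef_poly kN ffactnn.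
have -> z j : complex.Re (z *+ j) = complex.Re z *+ j :> R.
  by elim: j => [//|j IH]; rewrite !mulrSr ReD IH.
rewrite /= -[_ *+ k`!]mulr_natr mulrAC mulVf ?mul1r//.
Qed.

Definition re_ev z (D : P -> P) N : 'cV[R]_m := \col_i complex.Re (ev z (D (g N i))).

(* The real part of [proj10_deriv_iterate], where
   [d_w = (d_x + i d_y) / 2]. *)
Lemma level_equation z N (E : 'M[R]_m) :
  (forall j k, ev z (e N j k (g N)) = (E j k)%:C) ->
  2 *: (re_ev z (@dx _) N.+1 + J0 *m re_ev z (@dy _) N.+1) =
  J0 *m (E *m re_ev z (@dx _) N) - E *m re_ev z (@dy _) N.
Proof.
move=> evE.
pose Z N' := cmx (2^-1 *: re_ev z (@dx _) N') (2^-1 *: re_ev z (@dy _) N').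
have ZE N' i : Z N' i 0 = ev z (g N' i)^`().
  by rewrite ev_deriv ?sigma_iterate// !mxE.
have complex_eq : proj10 *m Z N.+1 = half_i_proj10 *m (cmx E 0 *m Z N).
  apply/matrixP => l j; rewrite [j]ord1 mxE [RHS]mxE.
  have := congr1 (ev z) (proj10_deriv_iterate N l).
  have ev_sum (I : finType) (f : I -> P) : ev z (\sum_i f i) = \sum_i ev z (f i).
    exact: (big_morph (ev z) (@evD R z) (ev0 z)).
  rewrite !ev_sum => ev_eq.
  rewrite (eq_bigr (fun i => ev z ((proj10 l i)%:P%:P * (g N.+1 i)^`()))); last first.
    by move=> i _; rewrite evM ev_polyC ZE.
  rewrite ev_eq; apply: eq_bigr => i _; rewrite evM ev_polyC; congr (_ * _).
  rewrite /field_term ev_sum mxE; apply: eq_bigr => k _.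
  by rewrite evM evE ZE !mxE.
rewrite /proj10 /half_i_proj10 /Z !cmxM in complex_eq; move/cmx_inj_Re: complex_eq.
rewrite -!scalemxAl -!scalemxAr -?scalemxAr !mul1mx !mul0mx ?scaler0 subr0 addr0 -?scalemxAr.
move: (J0 *m re_ev _ _ _) (J0 *m (E *m _)) (E *m re_ev z (@dy _) N) => u v w /matrixP eq_uvw.
by apply/matrixP => i j; have := eq_uvw i j; rewrite !mxE; lra.
Qed.

End Structure.

(** * Regularity and x-derivatives of the limit *)

Section Smoothness.
Variable R : realType.
Local Notation P := {poly {poly R[i]}}.
Local Notation normc := (@Normc.normc R).
Local Notation e0 := (delta_mx 0 0 : 'cV[R]_(1 + 1)).

Lemma unit_disc_open (v : 'cV[R]_(1 + 1)) : unit_disc v -> \forall w \near v, unit_disc w.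
Proof.
rewrite /unit_disc /= => v_lt1; apply/nbhs_ballP.
exists ((1 - enorm v) / 2); first by rewrite /= divr_gt0 ?subr_gt0.
move=> w /=; rewrite -ball_normE /ball_ /= distrC => w_v.
rewrite -(subrK v w) -normc_cz czD; apply: le_lt_trans (le_normcD _ _) _.
by rewrite (normc_cz v); have := normc_cz_le (w - v); lra.
Qed.

Lemma lim_col_diff1 k (p : nat -> 'I_k -> P) v :
  (forall s, 0 <= s -> s < 1 -> col_increments s p) -> unit_disc v ->
  differentiable (lim_col p) v /\
  'd (lim_col p) v = (fun h => h 0 0 *: lim_col (fun N i => dx (p N i)) v +
     h 1 0 *: lim_col (fun N i => dy (p N i)) v) :> (_ -> _).
Proof.
rewrite /unit_disc /= => p_inc v_lt1; have v_ge0 : 0 <= enorm v by apply: sqrtr_ge0.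
by apply: (@lim_col_diff _ _ ((enorm v + 1) / 2)); [apply: p_inc|]; lra.
Qed.

(** Each derivative costs some radius, here from [(s + 1) / 2] to [s]. Quantifying over all [s < 1]
    makes the property reproduce itself. *)
Lemma col_increments_iter_dx k (p : nat -> 'I_k -> P) j :
  (forall s, 0 <= s -> s < 1 -> col_increments s p) ->
  forall s, 0 <= s -> s < 1 -> col_increments s (fun N i => iter j (@dx _) (p N i)).
Proof.
move=> p_inc; elim: j => [//|j IH] s s_ge0 s_lt1.
apply: (@col_increments_dx _ _ ((s + 1) / 2) s) => //; first by lra.
by apply: IH; lra.
Qed.

Lemma iter_partial_x_lim_col k (p : nat -> 'I_k -> P) j v :
  (forall s, 0 <= s -> s < 1 -> col_increments s p) -> unit_disc v ->
  iter j partial_x (lim_col p) v = lim_col (fun N i => iter j (@dx _) (p N i)) v.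
Proof.
move=> p_inc; elim: j v => [//|j IH] v v_disc.
have [d_j d_jE] := lim_col_diff1 (col_increments_iter_dx j p_inc) v_disc.
rewrite iterS /partial_x
  (@near_eq_derive _ _ _ _ (lim_col (fun N i => iter j (@dx _) (p N i)))).
  by rewrite deriveE// d_jE !mxE /= scale1r scale0r addr0.
by apply: filterS (unit_disc_open v_disc) => w w_disc; apply: IH.
Qed.

Lemma derivable_iter_partial_x_lim_col k (p : nat -> 'I_k -> P) j v :
  (forall s, 0 <= s -> s < 1 -> col_increments s p) -> unit_disc v ->
  derivable (iter j partial_x (lim_col p)) v e0.
Proof.
move=> p_inc v_disc.
have [d_j _] := lim_col_diff1 (col_increments_iter_dx j p_inc) v_disc.
apply: (@near_eq_derivable _ _ _ (lim_col (fun N i => iter j (@dx _) (p N i))));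
  last exact: diff_derivable.
by apply: filterS (unit_disc_open v_disc) => w w_disc; rewrite iter_partial_x_lim_col.
Qed.

Lemma continuous_diff_lim_col k (p : nat -> 'I_k -> P) z h :
  (forall s, 0 <= s -> s < 1 -> col_increments s p) -> unit_disc z ->
  {for z, continuous (fun w => 'd (lim_col p) w h)}.
Proof.
move=> p_inc z_disc.
pose f w := h 0 0 *: lim_col (fun N i => dx (p N i)) w +
  h 1 0 *: lim_col (fun N i => dy (p N i)) w.
have f_cont : {for z, continuous f}.
  have dx_inc s : 0 <= s -> s < 1 -> col_increments s (fun N i => dx (p N i)).
    move=> s_ge0 s_lt1; apply: (@col_increments_dx _ _ ((s + 1) / 2) s) => //; first by lra.
    by apply: p_inc; lra.
  have dy_inc s : 0 <= s -> s < 1 -> col_increments s (fun N i => dy (p N i)).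
    move=> s_ge0 s_lt1; apply: (@col_increments_dy _ _ ((s + 1) / 2) s) => //; first by lra.
    by apply: p_inc; lra.
  apply: continuousD; apply: continuousZl_tmp; apply: differentiable_continuous.
    by have [] := lim_col_diff1 dx_inc z_disc.
  by have [] := lim_col_diff1 dy_inc z_disc.
have near_f : \forall w \near z, f w = 'd (lim_col p) w h.
  apply: filterS (unit_disc_open z_disc) => w w_disc.
  by have [_ ->] := lim_col_diff1 p_inc w_disc.
have fz : f z = 'd (lim_col p) z h by exact: nbhs_singleton near_f.
suff d_cvg : (fun w => 'd (lim_col p) w h) @ z --> f z by move: d_cvg; rewrite fz.
apply: cvg_trans f_cont.
exact: near_eq_cvg near_f.
Qed.

End Smoothness.

(** * Evaluation of the series, size of the data, invertibility *)

Section Evaluation.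
Variable R : realType.
Local Notation P := {poly {poly R[i]}}.
Local Notation normc := (@Normc.normc R).

Lemma norm_alg_norm : alg_norm (fun a : R => `|a|).
Proof.
split=> [||a|a b|a b]; rewrite ?normr0 ?normr1 ?normrN ?normrM//.
exact: ler_normD.
Qed.

Definition embed (a : R) : P := (a%:C)%:P%:P.

Lemma norm11_embed a : norm11 (embed a) = `|a|.
Proof. by rewrite norm11_CC /= expr0n addr0 sqrtr_sqr. Qed.

Lemma ev_box_sum m (c : {ffun 'I_m -> nat} -> R) N (g : 'I_m -> P) z (a : 'I_m -> R) :
  (forall i, ev z (g i) = (a i)%:C) ->
  ev z (box_sum embed c N g) = (box_sum idfun c N a)%:C.
Proof.
move=> g_a; rewrite /box_sum (big_morph (ev z) (@evD R z) (ev0 z)).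
rewrite [RHS]rmorph_sum; apply: eq_bigr => beta _.
rewrite evM ev_polyC [RHS]rmorphM; congr (_ * _).
rewrite (big_morph (ev z) (@evM R z) (ev1 z)) [RHS]rmorph_prod; apply: eq_bigr => i _.
transitivity ((a i)%:C ^+ box_index beta i); last by rewrite rmorphXn.
rewrite -g_a; elim: (box_index beta i) => [|k IH]; first by rewrite !expr0 ev1.
by rewrite !exprS evM IH.
Qed.

Lemma analytic_coefs m (J : 'cV[R]_m -> 'M[R]_m) :
  (forall i j, real_analytic_at (fun q => J q i j) 0) ->
  exists (c : 'I_m -> 'I_m -> {ffun 'I_m -> nat} -> R) (rho M : R),
    [/\ 0 < rho, 0 <= M, forall i j N, box_norm (c i j) rho N <= M &
      forall i j (h : 'cV[R]_m), (forall k, `|h k 0| <= rho) ->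
        (fun N => box_sum idfun (c i j) N (fun k => h k 0)) @ \oo --> J h i j].
Proof.
move=> J_an; have := choice (fun ij : 'I_m * 'I_m => real_analytic_at0 (J_an ij.1 ij.2)).
move=> [c /choice[r /choice[M cP]]].
have r_gt0 ij : 0 < r ij by case: (cP ij).
have box_ge0 (rho : R) ij N : 0 <= rho -> 0 <= box_norm (c ij) rho N.
  by move=> ?; apply: sumr_ge0 => beta _; rewrite mulr_ge0 ?exprn_ge0.
have M_ge0 ij : 0 <= M ij.
  have [_ cM _] := cP ij; apply: le_trans (cM 0%N); apply: box_ge0.
  exact: ltW.
(* [S^-1] is a radius below all the [r ij]; the 1 keeps it meaningful when there are no entries. *)
pose S := 1 + \sum_ij (r ij)^-1.
have S_gt0 : 0 < S.
  by rewrite ltr_wpDr// sumr_ge0// => ij _; rewrite invr_ge0 ltW.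
have S_r ij : S^-1 <= r ij.
  rewrite -[leRHS]invrK lef_pV2 ?posrE ?invr_gt0// /S (bigD1 ij)//=.
  by rewrite addrCA lerDl addr_ge0// sumr_ge0// => k _; rewrite invr_ge0 ltW.
exists (fun i j => c (i, j)), S^-1, (\sum_ij M ij); split=> [|||i j h h_small].
- by rewrite invr_gt0.
- exact: sumr_ge0.
- move=> i j N; have [_ cM _] := cP (i, j).
  apply: (@le_trans _ _ (M (i, j))); last by rewrite (bigD1 (i, j))//= lerDl sumr_ge0.
  apply: le_trans (cM N); apply: ler_sum => beta _; rewrite ler_wpM2l//.
  by rewrite lerXn2r ?nnegrE ?invr_ge0 ?(ltW S_gt0) ?(ltW (r_gt0 _)).
- have [_ _ c_cvg] := cP (i, j); apply: c_cvg => k.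
  exact: le_trans (h_small k) _.
Qed.

(** Multiplying (2 J0 + E) w = 0 by [J0] gives 2 w = J0 E w, and the l1 norm of the right-hand side
    is less than twice that of [w] unless [w] vanishes. *)
Lemma complex_structure_perturbation m (J0 E : 'M[R]_m) (w : 'cV[R]_m) (eps : R) :
  J0 *m J0 = - 1%:M -> (forall i j, `|E i j| <= eps) ->
  (\sum_i \sum_j `|J0 i j|) * eps < 2 -> ((J0 + E) + J0) *m w = 0 -> w = 0.
Proof.
move=> J0_sqr E_eps small w_ker; set S := \sum_k `|w k 0|.
have S_ge0 : 0 <= S by apply: sumr_ge0.
have w_eq : 2 *: w = J0 *m (E *m w).
  have /(congr1 (mulmx J0)) := w_ker.
  rewrite mulmx0 !mulmxDl !mulmxDr !mulmxA J0_sqr mulNmx mul1mx => /eqP.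
  by rewrite addrAC -opprD addrC subr_eq0 => /eqP ->; rewrite scaler_nat mulr2n.
have E_w j : `|(E *m w) j 0| <= eps * S.
  rewrite mxE mulr_sumr; apply: le_trans (ler_norm_sum _ _ _) _.
  by apply: ler_sum => k _; rewrite normrM ler_wpM2r.
have S_le : 2 * S <= (\sum_i \sum_j `|J0 i j|) * eps * S.
  rewrite -mulrA mulr_sumr mulr_suml; apply: ler_sum => i _.
  have -> : 2 * `|w i 0| = `|(2 *: w) i 0| by rewrite mxE normrM (ger0_norm (ler0n _ 2)).
  rewrite w_eq mxE mulr_suml; apply: le_trans (ler_norm_sum _ _ _) _.
  by apply: ler_sum => j _; rewrite normrM ler_wpM2l.
have S0 : S = 0.
  apply/eqP; rewrite eq_le S_ge0 andbT leNgt; apply/negP => S_gt0.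
  by move: S_le; rewrite ler_pM2r// leNgt small.
apply/matrixP => i j; rewrite [j]ord1 mxE; apply/eqP; rewrite -normr_le0.
by rewrite -S0 /S (bigD1 i)//= lerDl sumr_ge0.
Qed.

Lemma le_enorm m (v : 'cV[R]_m) i : `|v i 0| <= enorm v.
Proof.
rewrite /enorm -sqrtr_sqr ler_wsqrtr// (bigD1 i)//= lerDl.
by apply: sumr_ge0 => j _; rewrite sqr_ge0.
Qed.

Lemma norm11_monomial (c : R[i]) k :
  norm11 (c *: 'X^k)%:P <= k.+1%:R * normc c.
Proof.
rewrite /norm11 /pnorm2 pnormC;
  [|exact/pnorm_normc_alg_norm/weightS|exact: weightS].
apply: le_trans (pnormZ (normc_alg_norm R) _ _ (@weightS R)) _.
rewrite mulrC ler_wpM2r ?(alg_norm_ge0 (normc_alg_norm R))//.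
rewrite -['X^k]mul1r; apply: le_trans (pnormMXn (normc_alg_norm R) _ _ (@weightS R)) _.
by rewrite (alg_norm1 (pnorm_normc_alg_norm (@weightS R))) mulr1.
Qed.

Section CauchyData.
Variables (m : nat) (J0 : 'M[R]_m) (x : nat -> 'cV[R]_m).
Let kappa : R := \sum_i \sum_j normc (proj10 J0 i j).

(** The k-th power of z has norm at most [k + 1]: this turns the Taylor coefficient into the k-th
    term of the series bounded by [r]. *)
Lemma sum_norm11_taylor k :
  \sum_i norm11 (taylor_coef J0 x k i 0 *: 'X^k)%:P <=
  kappa * (k.+1%:R / k`!%:R * enorm (x k)).
Proof.
have normc_ge0 (z : R[i]) : 0 <= normc z := alg_norm_ge0 (normc_alg_norm R) z.
rewrite mulr_suml; apply: ler_sum => i _; apply: le_trans (norm11_monomial _ _) _.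
rewrite -[k.+1%:R / _ * _]mulrA mulrCA ler_wpM2l// mxE mulr_suml.
apply: le_trans (alg_norm_sum (normc_alg_norm R) _ _ _) _; apply: ler_sum => j _.
rewrite Normc.normcM ler_wpM2l// !mxE /= expr0n addr0 sqrtr_sqr normrM ger0_norm//.
by rewrite ler_wpM2l// le_enorm.
Qed.

Lemma dist11_cauchy_data_step N :
  dist11 (cauchy_data J0 x N.+1) (cauchy_data J0 x N) <=
  kappa * (N.+1%:R / N`!%:R * enorm (x N)).
Proof.
apply: le_trans (sum_norm11_taylor N); apply: ler_sum => i _.
by rewrite /cauchy_data big_ord_recr polyCD addrAC subrr add0r.
Qed.

Lemma dist11_cauchy_data N : dist11 (cauchy_data J0 x N) (fun=> 0) <=
  kappa * \sum_(k < N) (k.+1%:R / k`!%:R * enorm (x k)).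
Proof.
elim: N => [|N IH].
  rewrite big_ord0 mulr0 /dist11 big1// => i _.
  by rewrite /cauchy_data big_ord0 polyC0 subrr (alg_norm0 (norm11P R)).
rewrite big_ord_recr mulrDr /= addrC.
apply: le_trans (dist11_trans _ (cauchy_data J0 x N) _) _.
by apply: lerD => //; apply: dist11_cauchy_data_step.
Qed.

End CauchyData.
End Evaluation.

Lemma lim_col_le (R : realType) k (p : nat -> 'I_k -> {poly {poly R[i]}}) v b i :
  col_increments 1 p -> unit_disc v -> (forall N, norm11 (p N i) <= b) ->
  `|lim_col p v i 0| <= b.
Proof.
move=> p_inc v_disc p_b; have v_lt1 : enorm v < 1 by [].
have p_cvg := lim_col_cvg (i:=i) p_inc (ltW v_lt1).
have norm_cvg : (fun N => `|complex.Re (ev (cz v) (p N i))|) @ \oo --> `|lim_col p v i 0|.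
  exact: cvg_norm p_cvg.
rewrite -(cvg_lim _ norm_cvg)//; apply: limr_le; first exact: cvgP norm_cvg.
apply: nearW => N; apply: le_trans (normc_ge_Re_real _) _; apply: le_trans (p_b N).
by apply: le_trans (norm_disc1_le _); apply: ev_le_norm_disc; rewrite normc_cz ltW.
Qed.

(** * Passage to the limit in the equation *)

Section LimitEquation.
Variables (R : realType) (m : nat).
Local Notation P := {poly {poly R[i]}}.
Local Notation normc := (@Normc.normc R).
Variables (c : 'I_m -> 'I_m -> {ffun 'I_m -> nat} -> R) (rho M : R).
Hypothesis rho_gt0 : 0 < rho.
Hypothesis box_M : forall i j N, box_norm (c i j) rho N <= M.

(** An approximation of E = J - J(0). The truncation's own value at 0 is subtracted, so that it
    vanishes at 0 exactly, whatever [N] is. *)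
Definition truncation N j k (g : 'I_m -> P) : P :=
  box_sum (@embed R) (c j k) N g - box_sum (@embed R) (c j k) N (fun=> 0).

Lemma truncation0 N j k : truncation N j k (fun=> 0) = 0.
Proof. by rewrite /truncation subrr. Qed.

Lemma truncation_lipschitz N j k g g' :
  (forall i, norm11 (g i) <= rho / 2) -> (forall i, norm11 (g' i) <= rho / 2) ->
  norm11 (truncation N j k g - truncation N j k g') <= 2 / rho * M * dist11 g g'.
Proof.
move=> g_rho g'_rho; have -> : truncation N j k g - truncation N j k g' =
    box_sum (@embed R) (c j k) N g - box_sum (@embed R) (c j k) N g'.
  by rewrite /truncation opprB addrA subrK.
apply: le_trans (box_sum_lipschitz (norm11P R) (@norm11_embed R) _ _ rho_gt0 g_rho g'_rho) _.
by rewrite ler_wpM2r ?dist11_ge0// ler_wpM2l// mulr_ge0// invr_ge0 ltW.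
Qed.

(** The factor 2 accounts for the sum at [g] and the sum at 0; adding over all entries gives a bound
    independent of [j] and [k]. *)
Definition truncation_step N : R :=
  2 * \sum_j \sum_k (box_norm (c j k) rho N.+1 - box_norm (c j k) rho N).

Lemma norm11_truncation_step N j k g : (forall i, norm11 (g i) <= rho / 2) ->
  norm11 (truncation N.+1 j k g - truncation N j k g) <= truncation_step N.
Proof.
move=> g_rho; have step0 := box_sum_step (norm11P R) (@norm11_embed R).
have zero_rho i : norm11 ((fun _ : 'I_m => 0) i) <= rho.
  by rewrite (alg_norm0 (norm11P R)) ltW.
have g_le_rho i : norm11 (g i) <= rho.
  by apply: le_trans (g_rho i) _; rewrite ler_pdivrMr// ler_peMr ?ltW// ltr1n.
have diff_ge0 j' k' : 0 <= box_norm (c j' k') rho N.+1 - box_norm (c j' k') rho N.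
  by apply: le_trans (step0 _ _ N _ _ zero_rho); apply: alg_norm_ge0 (norm11P R) _.
have -> : truncation N.+1 j k g - truncation N j k g =
    (box_sum (@embed R) (c j k) N.+1 g - box_sum (@embed R) (c j k) N g) -
    (box_sum (@embed R) (c j k) N.+1 (fun=> 0) - box_sum (@embed R) (c j k) N (fun=> 0)).
  by rewrite /truncation !opprB addrACA [RHS]addrACA [X in _ + X = _]addrC.
apply: le_trans (alg_normB (norm11P R) _ _) _.
apply: le_trans (lerD (step0 _ _ _ _ _ g_le_rho) (step0 _ _ _ _ _ zero_rho)) _.
rewrite /truncation_step -mulr2n -[X in X <= _]mulr_natl ler_wpM2l//.
rewrite (bigD1 j)//= (bigD1 k)//= -addrA lerDl addr_ge0//; first exact: sumr_ge0.
by apply: sumr_ge0 => j' _; apply: sumr_ge0.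
Qed.

Lemma sum_truncation_step N' :
  \sum_(N < N') truncation_step N <= 2 * \sum_(j < m) \sum_(k < m) M.
Proof.
rewrite -mulr_sumr ler_wpM2l// exchange_big; apply: ler_sum => j _ /=.
rewrite exchange_big; apply: ler_sum => k _ /=.
rewrite -(big_mkord xpredT (fun N => box_norm (c j k) rho N.+1 - box_norm (c j k) rho N)).
rewrite telescope_sumr//; apply: le_trans (box_M j k N'); rewrite lerBlDr lerDl.
by apply: sumr_ge0 => beta _; rewrite mulr_ge0 ?exprn_ge0 ?(ltW rho_gt0)//.
Qed.

Lemma cvg_sum_ord k (F : 'I_k -> nat -> R) (l : 'I_k -> R) :
  (forall i, F i @ \oo --> l i) ->
  (fun N => \sum_i F i N) @ \oo --> \sum_i l i.
Proof.
by move=> F_l; apply: (@cvg_big _ _ +%R 0 xpredT) => [|i _]; [exact: add_continuous|].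
Qed.

Lemma cvg_mulmx k l p (A : nat -> 'M[R]_(k, l)) (B : nat -> 'M[R]_(l, p))
    (A' : 'M[R]_(k, l)) (B' : 'M[R]_(l, p)) :
  (forall i j, (fun N => A N i j) @ \oo --> A' i j) ->
  (forall i j, (fun N => B N i j) @ \oo --> B' i j) ->
  forall i j, (fun N => (A N *m B N) i j) @ \oo --> (A' *m B') i j.
Proof.
move=> A_cvg B_cvg i j; rewrite mxE.
have -> : (fun N => (A N *m B N) i j) = (fun N => \sum_s A N i s * B N s j).
  by apply/funext => N; rewrite mxE.
by apply: cvg_sum_ord => s; apply: cvgM.
Qed.

Variables (J : 'cV[R]_m -> 'M[R]_m) (J0 : 'M[R]_m) (x : nat -> 'cV[R]_m).
Hypothesis J0_sqr : J0 *m J0 = - 1%:M.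
Hypothesis J_cvg : forall i j (h : 'cV[R]_m), (forall k, `|h k 0| <= rho) ->
  (fun N => box_sum idfun (c i j) N (fun k => h k 0)) @ \oo --> J h i j.

(** The limit of the estimates of the truncations. It keeps [J] close to [J 0] along the disc, as
    the invertibility of their sum requires. *)
Lemma analytic_lipschitz j k (h : 'cV[R]_m) : (forall i, `|h i 0| <= rho / 2) ->
  `|J h j k - J 0 j k| <= 2 / rho * M * \sum_i `|h i 0|.
Proof.
move=> h_small; have zero_small (i : 'I_m) : `|(0 : 'cV[R]_m) i 0| <= rho / 2.
  by rewrite mxE normr0 divr_ge0// ltW.
have half_rho : rho / 2 <= rho by rewrite ler_pdivrMr// ler_peMr ?ltW// ltr1n.
have h_cvg := @J_cvg j k _ (fun i => le_trans (h_small i) half_rho).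
have zero_cvg := @J_cvg j k _ (fun i => le_trans (zero_small i) half_rho).
have norm_cvg : (fun N => `|box_sum idfun (c j k) N (fun i => h i 0) -
    box_sum idfun (c j k) N (fun i => (0 : 'cV[R]_m) i 0)|) @ \oo --> `|J h j k - J 0 j k|.
  by apply: cvg_norm; apply: cvgB.
rewrite -(cvg_lim _ norm_cvg)//; apply: limr_le; first exact: cvgP norm_cvg.
apply: nearW => N; have idfun_norm (a : R) : `|idfun a| = `|a| by [].
apply: le_trans (box_sum_lipschitz (norm_alg_norm R) idfun_norm (c j k) N rho_gt0
  h_small zero_small) _.
have -> : \sum_i `|h i 0 - (0 : 'cV[R]_m) i 0| = \sum_i `|h i 0|.
  by apply: eq_bigr => i _; rewrite mxE subr0.
by rewrite ler_wpM2r ?sumr_ge0// ler_wpM2l// divr_ge0 ?ltW.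
Qed.

Local Notation g := (iterate (half_i_proj10 J0) truncation (cauchy_data J0 x)).
Hypothesis g_inc : col_increments 1 g.
Hypothesis g_rho : forall N i, norm11 (g N i) <= rho / 2.
Variable v : 'cV[R]_(1 + 1).
Hypothesis v_disc : unit_disc v.

Let v_lt1 : enorm v < 1 := v_disc.

Let ev_real_part D N i : (forall p : P, sigma (D p) = D (sigma p)) ->
  ev (cz v) (D (g N i)) = (complex.Re (ev (cz v) (D (g N i))))%:C.
Proof. by move=> D_sigma; apply: ev_real; rewrite D_sigma sigma_iterate. Qed.

Let re_g N : 'cV[R]_m := \col_i complex.Re (ev (cz v) (g N i)).

Let re_g_small N i : `|re_g N i 0| <= rho / 2.
Proof.
rewrite mxE; apply: le_trans (normc_ge_Re_real _) _; apply: le_trans (g_rho N i).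
apply: le_trans (norm_disc1_le _); apply: ev_le_norm_disc.
by rewrite normc_cz ltW.
Qed.

Let lim_small i : `|lim_col g v i 0| <= rho / 2.
Proof. exact: lim_col_le g_inc v_disc (fun N => g_rho N i). Qed.

Let trunc_real N (h : 'I_m -> R) : 'M[R]_m :=
  \matrix_(j, k) (box_sum idfun (c j k) N h - box_sum idfun (c j k) N (fun=> 0)).

(** Order and argument vary together. The Lipschitz bound is uniform in the order, so the argument
    can first be replaced by its limit. *)
Let trunc_real_cvg j k :
  (fun N => trunc_real N (fun i => re_g N i 0) j k) @ \oo -->
  (J (lim_col g v) - J 0) j k.
Proof.
pose y := lim_col g v.
have y_rho i : `|y i 0| <= rho.
  apply: le_trans (lim_small i) _.
  by rewrite ler_pdivrMr// ler_peMr ?ltW// ltr1n.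
have zero_rho (i : 'I_m) : `|(0 : 'cV[R]_m) i 0| <= rho by rewrite mxE normr0 ltW.
have y_cvg := @J_cvg j k _ y_rho; have zero_cvg := @J_cvg j k _ zero_rho.
have diff_cvg : (fun N => box_sum idfun (c j k) N (fun i => re_g N i 0) -
    box_sum idfun (c j k) N (fun i => y i 0)) @ \oo --> (0 : R).
  have bound_cvg : (fun N => 2 / rho * M * \sum_i `|re_g N i 0 - y i 0|) @ \oo --> (0 : R).
    rewrite -[X in _ --> X](mulr0 (2 / rho * M)); apply: cvgM; first exact: cvg_cst.
    have sum_cvg : (fun N => \sum_i `|re_g N i 0 - y i 0|) @ \oo --> \sum_(i < m) `|(0 : R)|.
      apply: cvg_sum_ord => i; apply: cvg_norm.
      have -> : (fun N => re_g N i 0 - y i 0) =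
          (fun N => complex.Re (ev (cz v) (g N i)) - y i 0).
        by apply/funext => N; rewrite mxE.
      rewrite -[X in _ --> X](subrr (y i 0)); apply: cvgB; last exact: cvg_cst.
      exact: lim_col_cvg g_inc (ltW v_lt1).
    by rewrite big1 in sum_cvg => // i _; rewrite normr0.
  apply/cvgr0Pnorm_lt => eps eps_gt0.
  move/cvgr0Pnorm_lt : bound_cvg => /(_ _ eps_gt0); apply: filterS => N.
  apply: le_lt_trans.
  have idfun_norm (a : R) : `|idfun a| = `|a| by [].
  apply: le_trans (box_sum_lipschitz (norm_alg_norm R) idfun_norm (c j k) N rho_gt0
    (re_g_small N) lim_small) _.
  apply: le_trans (ler_norm _); rewrite ler_wpM2r ?sumr_ge0// ler_wpM2l//.
  by rewrite divr_ge0 ?ltW.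
have -> : (J y - J 0) j k = 0 + J y j k - J 0 j k by rewrite !mxE add0r.
have -> : (fun N => trunc_real N (fun i => re_g N i 0) j k) = (fun N =>
    (box_sum idfun (c j k) N (fun i => re_g N i 0) - box_sum idfun (c j k) N (fun i => y i 0)) +
    box_sum idfun (c j k) N (fun i => y i 0) -
    box_sum idfun (c j k) N (fun i => (0 : 'cV[R]_m) i 0)).
  apply/funext => N; rewrite mxE subrK; congr (_ - box_sum _ _ _ _).
  by apply/funext => i; rewrite mxE.
by apply: cvgB => //; apply: cvgD.
Qed.

Lemma limit_equation :
  let A := lim_col (fun N i => dx (g N i)) v in
  let B := lim_col (fun N i => dy (g N i)) v in
  let E := J (lim_col g v) - J 0 in
  2 *: (A + J0 *m B) = J0 *m (E *m A) - E *m B.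
Proof.
move=> A B E; have v_ge0 : 0 <= enorm v by apply: sqrtr_ge0.
pose s := (enorm v + 1) / 2; have s_ge0 : 0 <= s by rewrite /s; lra.
have s_lt1 : s < 1 by rewrite /s; have := v_lt1; lra.
have v_s : enorm v <= s by rewrite /s; have := v_lt1; lra.
have dx_cvg i j : (fun N => re_ev J0 x truncation (cz v) (@dx _) N i j) @ \oo --> A i j.
  rewrite [j]ord1 /re_ev; under eq_fun do rewrite mxE.
  exact: lim_col_cvg (col_increments_dx s_ge0 s_lt1 g_inc) v_s.
have dy_cvg i j : (fun N => re_ev J0 x truncation (cz v) (@dy _) N i j) @ \oo --> B i j.
  rewrite [j]ord1 /re_ev; under eq_fun do rewrite mxE.
  exact: lim_col_cvg (col_increments_dy s_ge0 s_lt1 g_inc) v_s.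
have ev_trunc N j k : ev (cz v) (truncation N j k (g N)) =
    (trunc_real N (fun i => re_g N i 0) j k)%:C.
  have re_gE i : ev (cz v) (g N i) = (re_g N i 0)%:C.
    by rewrite mxE; apply: (ev_real_part (D := id)).
  rewrite /truncation evB (ev_box_sum _ _ re_gE) (ev_box_sum _ _ (fun=> ev0 _)).
  by rewrite mxE rmorphB.
have J0_cvg i j : (fun N : nat => J0 i j) @ \oo --> J0 i j by apply: cvg_cst.
apply/matrixP => i j.
pose lhs := (fun N => (2 *: (re_ev J0 x truncation (cz v) (@dx _) N.+1 +
    J0 *m re_ev J0 x truncation (cz v) (@dy _) N.+1)) i j).
have lhs_cvg : lhs @ \oo --> (2 *: (A + J0 *m B)) i j.
  have := cvg_mulmx J0_cvg dy_cvg => mul_cvg.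
  (* The left-hand side of [level_equation] sits at the next iterate, which has the same limit. *)
  rewrite /lhs (cvg_shiftS (fun N => (2 *: (re_ev J0 x truncation (cz v) (@dx _) N +
    J0 *m re_ev J0 x truncation (cz v) (@dy _) N)) i j)).
  rewrite mxE [X in _ * X]mxE; under eq_fun do rewrite mxE [X in _ * X]mxE.
  by apply: cvgM; [exact: cvg_cst|apply: cvgD].
pose rhs := (fun N => (J0 *m (trunc_real N (fun i => re_g N i 0) *m
      re_ev J0 x truncation (cz v) (@dx _) N) -
    trunc_real N (fun i => re_g N i 0) *m re_ev J0 x truncation (cz v) (@dy _) N) i j).
have rhs_cvg : rhs @ \oo
    --> (J0 *m (E *m A) - E *m B) i j.
  rewrite /rhs mxE [X in _ + X]mxE; under eq_fun do rewrite mxE [X in _ + X]mxE.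
  apply: cvgB; last exact: (cvg_mulmx trunc_real_cvg dy_cvg).
  exact: (cvg_mulmx J0_cvg (cvg_mulmx trunc_real_cvg dx_cvg)).
have lhs_rhs : lhs = rhs.
  by apply/funext => N; rewrite /lhs (level_equation J0_sqr (ev_trunc N)).
by rewrite -(cvg_lim _ lhs_cvg)// -(cvg_lim _ rhs_cvg)// lhs_rhs.
Qed.

End LimitEquation.

(** * Choice of the radius and conclusion *)

Lemma invr_sum_le (R : realFieldType) (a S : R) : 0 < a -> a <= S -> S^-1 <= a^-1.
Proof. by move=> a_gt0 aS; rewrite lef_pV2 ?posrE// (lt_le_trans a_gt0). Qed.

(* With [E = J - J0], the hypothesis is the real part of
   [(1 - i J0) (J + i) (A + i B) = 0]. *)
Lemma projected_equation (R : realType) m (J J0 : 'M[R]_m) (A B : 'cV[R]_m) :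
  J *m J = - 1%:M -> J0 *m J0 = - 1%:M ->
  2 *: (A + J0 *m B) = J0 *m ((J - J0) *m A) - (J - J0) *m B ->
  (J + J0) *m (J *m A - B) = 0.
Proof.
move=> J_sqr J0_sqr.
rewrite !mulmxBl !mulmxBr !mulmxDl !mulmxA J_sqr J0_sqr !mulNmx !mul1mx.
move: (J *m B) (J0 *m B) (J0 *m J *m A) => u v w /matrixP eq_uvw.
by apply/matrixP => i j; have := eq_uvw i j; rewrite !mxE; lra.
Qed.

Lemma mul_Jstd1 (R : realType) (h : 'cV[R]_(1 + 1)) :
  (Jstd 1 *m h) 0 0 = - h 1 0 /\ (Jstd 1 *m h) 1 0 = h 0 0.
Proof.
have ord0E : 0 = lshift 1 (0 : 'I_1) :> 'I_(1 + 1) by apply: val_inj.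
have ord1E : 1 = rshift 1 (0 : 'I_1) :> 'I_(1 + 1) by apply: val_inj.
rewrite -(vsubmxK h) /Jstd mul_block_col !mul0mx mulNmx !mul1mx add0r addr0 ord0E ord1E.
by rewrite !col_mxEu !col_mxEd mxE.
Qed.

(** Separates the construction from the calculus: the disc is delivered as polynomials whose limits
    satisfy the equation in terms of [dx] and [dy]. *)
Lemma disc_approximation (R : realType) m (U : set 'cV[R]_m)
    (J : 'cV[R]_m -> 'M[R]_m) :
  open U -> U 0 -> (forall i j, real_analytic_at (fun q => J q i j) 0) ->
  (forall p, U p -> J p *m J p = - 1%:M) ->
  exists2 r : R, 0 < r & forall x : nat -> 'cV[R]_m,
    (\sum_(0 <= k <oo) ((k.+1%:R / (k`!)%:R) * enorm (x k))%:E <= r%:E)%E ->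
    exists g : nat -> 'I_m -> {poly {poly R[i]}},
      [/\ forall s, 0 <= s -> s < 1 -> col_increments s g,
          forall v, unit_disc v -> U (lim_col g v),
          forall v, unit_disc v -> lim_col (fun N i => dy (g N i)) v =
            J (lim_col g v) *m lim_col (fun N i => dx (g N i)) v &
          forall N k i, (k < N)%N ->
            complex.Re (ev 0 (iter k (@dx _) (g N.+1 i))) = x k i 0].
Proof.
move=> U_open U_0 J_analytic J_sqr.
have [J0 J0E] : exists J0, J0 = J 0 by exists (J 0).
have J0_sqr : J0 *m J0 = - 1%:M by rewrite J0E J_sqr.
have [c [rho [M [rho_gt0 M_ge0 box_M J_cvg]]]] := analytic_coefs J_analytic.
have /nbhs_ballP[e /= e_gt0 ball_U] : nbhs (0 : 'cV[R]_m) U.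
  by apply: open_nbhs_nbhs; split.
pose normc := @Normc.normc R.
have normc_ge0 z : 0 <= normc z := alg_norm_ge0 (normc_alg_norm R) z.
pose kQ : R := \sum_i \sum_j normc (half_i_proj10 J0 i j).
pose kP : R := \sum_i \sum_j normc (proj10 J0 i j).
pose kJ : R := \sum_i \sum_j `|J0 i j|.
have kQ_ge0 : 0 <= kQ by apply: sumr_ge0 => i _; apply: sumr_ge0.
have kP_ge0 : 0 <= kP by apply: sumr_ge0 => i _; apply: sumr_ge0.
have kJ_ge0 : 0 <= kJ by apply: sumr_ge0 => i _; apply: sumr_ge0.
pose L := 2 / rho * M; pose d : R := m%:R.
have L_ge0 : 0 <= L by rewrite mulr_ge0// divr_ge0// ltW.
have d_ge0 : 0 <= d by apply: ler0n.
have rho2_gt0 : 0 < 2 / rho by rewrite divr_gt0.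
have e2_gt0 : 0 < 2 / e by rewrite divr_gt0.
have c1_ge0 : 0 <= 32 * kQ * d * L by do 3![apply: mulr_ge0 => //].
have c2_ge0 : 0 <= kJ * (L * d) by do 2![apply: mulr_ge0 => //].
(* One term for each demand on [R0]: convergence of the series, values in [U], contraction,
   invertibility of J + J0. The final 1 makes [S] positive in any case. *)
pose S := 2 / rho + 2 / e + 32 * kQ * d * L + kJ * (L * d) + 1.
have S_gt0 : 0 < S by rewrite /S; lra.
pose R0 := S^-1; have R0_gt0 : 0 < R0 by rewrite invr_gt0.
have R0_rho : R0 <= rho / 2.
  have -> : rho / 2 = (2 / rho)^-1 by rewrite invfM invrK mulrC.
  by apply: invr_sum_le => //; rewrite /S; lra.
have R0_e : R0 <= e / 2.
  have -> : e / 2 = (2 / e)^-1 by rewrite invfM invrK mulrC.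
  by apply: invr_sum_le => //; rewrite /S; lra.
have R0_contraction : 16 * kQ * d * L * R0 <= 2^-1.
  have : 32 * kQ * d * L * R0 <= 1 by rewrite ler_pdivrMr// mul1r /S; lra.
  by lra.
have R0_invertible : kJ * (L * (d * R0)) < 2.
  have : kJ * (L * d) * R0 <= 1 by rewrite ler_pdivrMr// mul1r /S; lra.
  by rewrite !mulrA; lra.
(* Chosen so that [kP] times the bound is at most [R0 / 4], as [hh_small] demands; adding 1 avoids a
   division by zero. *)
exists (R0 / (4 * (kP + 1))); first by rewrite divr_gt0// mulr_gt0//; lra.
move=> x x_small.
have x_sum N : kP * (\sum_(k < N) k.+1%:R / k`!%:R * enorm (x k)) <= R0 / 4.
  have x_ge0 k : 0 <= k.+1%:R / k`!%:R * enorm (x k).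
    by rewrite !mulr_ge0 ?invr_ge0 ?sqrtr_ge0.
  have x_le : \sum_(k < N) k.+1%:R / k`!%:R * enorm (x k) <= R0 / (4 * (kP + 1)).
    rewrite -lee_fin; apply: le_trans x_small; rewrite -sumEFin.
    rewrite -(big_mkord xpredT (fun k => (k.+1%:R / k`!%:R * enorm (x k))%:E)).
    by apply: nneseries_lim_ge => k _ _; rewrite lee_fin.
  apply: le_trans (ler_wpM2l kP_ge0 x_le) _.
  have -> : kP * (R0 / (4 * (kP + 1))) = R0 / 4 * (kP / (kP + 1)).
    by field; rewrite gt_eqF//; lra.
  by rewrite ler_piMr ?divr_ge0 ?(ltW R0_gt0)// ler_pdivrMr; lra.
pose g := iterate (half_i_proj10 J0) (truncation c) (cauchy_data J0 x).
have trunc_lip := truncation_lipschitz rho_gt0 box_M.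
have trunc_step := norm11_truncation_step c rho_gt0.
have data_small N : dist11 (cauchy_data J0 x N) (fun=> 0) <= R0 / 4.
  exact: le_trans (dist11_cauchy_data _ _ _) (x_sum N).
have g_ball N : dist11 (g N) (fun=> 0) <= R0.
  exact: (iterate_ball L_ge0 (ltW R0_gt0) R0_rho trunc_lip (truncation0 c)).
have [B g_B] : exists B, forall N', \sum_(N < N') dist11 (g N.+1) (g N) <= B.
  apply: (iterate_summable L_ge0 (ltW R0_gt0) R0_rho trunc_lip (truncation0 c)
    trunc_step R0_contraction data_small (sum_truncation_step rho_gt0 box_M)
    (B := R0 / 4)) => N'.
  apply: le_trans (x_sum N'); rewrite mulr_sumr; apply: ler_sum => N _.
  exact: dist11_cauchy_data_step.
have norm11_g N i : norm11 (g N i) <= R0.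
  by apply: le_trans (g_ball N); have := le_dist11 (g N) (fun=> 0) i; rewrite subr0.
have g_inc1 : col_increments 1 g.
  move=> i; exists B => N'; apply: le_trans (g_B N'); apply: ler_sum => N _.
  exact: le_trans (norm_disc1_le _) (le_dist11 _ _ i).
have g_inc s : 0 <= s -> s < 1 -> col_increments s g.
  move=> s_ge0 s_lt1 i; have [b g_b] := g_inc1 i; exists b => N'.
  apply: le_trans (g_b N'); apply: ler_sum => N _; apply: norm_disc_le => //.
  exact: ltW.
pose gamma := lim_col g.
have gamma_small v i : unit_disc v -> `|gamma v i 0| <= R0.
  by move=> v_disc; apply: lim_col_le g_inc1 v_disc _ => N.
have gamma_U v : unit_disc v -> U (gamma v).
  move=> v_disc; apply: ball_U; rewrite -ball_normE /ball_ /= sub0r normrN.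
  apply: le_lt_trans (col_norm_le (ltW R0_gt0) (fun i => gamma_small v i v_disc)) _.
  by lra.
have dy_dx v : unit_disc v ->
    lim_col (fun N i => dy (g N i)) v = J (gamma v) *m lim_col (fun N i => dx (g N i)) v.
  move=> v_disc; set B' := lim_col _ v; set A' := lim_col _ v.
  have := limit_equation rho_gt0 box_M J0_sqr J_cvg g_inc1
    (fun N i => le_trans (norm11_g N i) R0_rho) v_disc.
  rewrite /= -/g -/A' -/B' -/gamma -J0E => lim_eq.
  have Jv_sqr := J_sqr _ (gamma_U v v_disc).
  set Jv := J (gamma v) in lim_eq Jv_sqr *.
  (* The projected equation places J A' - B' in the kernel of J + J0, which is trivial. *)
  apply/esym/subr0_eq.
  apply: (@complex_structure_perturbation _ _ J0 (Jv - J0) _ (L * (d * R0)) J0_sqr) => //.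
    move=> i j; have := analytic_lipschitz rho_gt0 box_M J_cvg i j
      (fun k => le_trans (gamma_small v k v_disc) R0_rho).
    rewrite -J0E -/Jv [(Jv - J0) i j]mxE [(- J0) i j]mxE => /le_trans; apply.
    rewrite ler_wpM2l//; apply: le_trans (_ : \sum_(k < m) R0 <= _).
      by apply: ler_sum => k _; apply: gamma_small.
    by rewrite sumr_const card_ord -[_ *+ _]mulr_natl.
  rewrite [J0 + _]addrC subrK.
  exact: projected_equation.
exists g; split=> // N k i kN; exact: Re_ev_dx_iterate.
Qed.

Theorem theorem3p1 (R : realType) (n : nat)
    (U : set 'cV[R]_(n + n)) (J : 'cV[R]_(n + n) -> 'M[R]_(n + n))
    (U_open : open U) (U_0 : U 0)
    (J_analytic : real_analytic_on U J)
    (J_almost_complex : almost_complex_on U J)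
    (J_0 : J 0 = Jstd n) :
  exists2 r : R, 0 < r &
    forall x : nat -> 'cV[R]_(n + n),
      (\sum_(0 <= k <oo) ((k.+1%:R / (k`!)%:R) * enorm (x k))%:E <= r%:E)%E ->
      exists2 gamma : 'cV[R]_(1 + 1) -> 'cV[R]_(n + n),
        J_holomorphic_disc U J gamma & has_x_jet gamma x.
Proof.
have [r r_gt0 disc_r] := disc_approximation U_open U_0 (J_analytic 0 U_0) J_almost_complex.
exists r => // x x_r; have [g [g_inc g_U g_dy g_jet]] := disc_r x x_r.
exists (lim_col g); first split=> //.
- by move=> z z_disc; have [] := lim_col_diff1 g_inc z_disc.
- by move=> h z z_disc; apply: continuous_diff_lim_col.
- move=> z z_disc h; have [_ ->] := lim_col_diff1 g_inc z_disc.
  rewrite (g_dy z z_disc); have Jz_sqr := J_almost_complex _ (g_U z z_disc).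
  set A := lim_col _ z.
  have [-> ->] := mul_Jstd1 h.
  (* With d_y gamma = J d_x gamma, both sides agree by J^2 = -1. *)
  by rewrite mulmxDr -!scalemxAr mulmxA Jz_sqr mulNmx mul1mx scalerN scaleNr addrC.
have disc0 : unit_disc (0 : 'cV[R]_(1 + 1)).
  rewrite /unit_disc /= /enorm big1 ?sqrtr0 ?ltr01// => i _.
  by rewrite mxE expr0n.
move=> k; split.
  apply: filterS (unit_disc_open disc0) => z z_disc.
  exact: derivable_iter_partial_x_lim_col.
rewrite iter_partial_x_lim_col//; apply/matrixP => i j; rewrite [j]ord1 mxE.
(* From the iterate of index [k + 2] on the derivative of order [k] at 0 is exact, so the sequence
   is eventually constant. *)
apply: lim_near_cst => //; exists k.+2 => // -[|N] //= kN.
have -> : cz (0 : 'cV[R]_(1 + 1)) = 0 by rewrite /cz !mxE.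
exact: g_jet.
Qed.
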